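(* Given a directed graph with nonnegative integer edge weights and $0<\epsilon\le1$, one can compute, for every vertex $x$, a value $\hat{\mu}(x)$ with $\mu(x)\le\hat{\mu}(x)\le(1+\epsilon)\mu(x)$ in time $$O\left(\frac{n^{\omega}}{\epsilon}\log^3\left(\frac{nW}{\epsilon}\right)\log^2\left(\frac{\log\left(\frac{nW}{\epsilon}\right)}{\epsilon}\right)\log(n)\right)=\widetilde{O}\left(\frac{n^{\omega}}{\epsilon}\log^3\left(\frac{nW}{\epsilon}\right)\right).$$
   Context: $G=(V,E,w)$ is a directed graph with $n$ vertices, every vertex having at least one outgoing edge, and $w$ assigning a nonnegative integer weight to each edge; $W$ is the maximum edge weight. A cycle is a path (edges may repeat) whose start and end vertex coincide; its mean weight is the sum of its edge weights divided by its number of edges. $\mu(x)$ is the minimum mean weight of a cycle reachable from $x$. $\omega$ denotes the exponent of classic matrix multiplication (two $n\times n$ matrices can be multiplied in time $O(n^\omega)$). The notation $\widetilde{O}(T)$ means $O(T\cdot\mathrm{polylog}(n))$. *)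

(* Defs.v *)
From mathcomp Require Import all_boot all_order all_algebra.
From mathcomp Require Import reals exp.

Set Implicit Arguments.
Unset Strict Implicit.
Unset Printing Implicit Defensive.

Import Order.TTheory GRing.Theory Num.Theory.

(** Memory holds natural numbers.  Besides scalar variables there are named
    zero-based arrays of unbounded extent; a fixed program names only finitely
    many of them, so they stand for interleaved parts of one RAM memory. *)
Record store := Store { var : nat -> nat; arr : nat -> nat -> nat }.

(** [Sub] truncates at [0]; [Div] is the integer quotient ([x / 0 = 0]). *)
Inductive binop := Add | Sub | Mul | Div.

Inductive expr :=
| Const of nat
| Var of nat
| Read of nat & expr
| Op of binop & expr & expr.

Definition eval_op (o : binop) (x y : nat) : nat :=
  match o with
  | Add => x + y
  | Sub => x - y
  | Mul => x * y
  | Div => x %/ y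
  end.

Fixpoint eval (s : store) (e : expr) : nat :=
  match e with
  | Const c => c
  | Var x => var s x
  | Read a i => arr s a (eval s i)
  | Op o e1 e2 => eval_op o (eval s e1) (eval s e2)
  end.

Definition upd (T : Type) (f : nat -> T) (x : nat) (v : T) : nat -> T :=
  fun y => if y == x then v else f y.

Definition upd2 (T : Type) (f : nat -> nat -> T) (a i : nat) (v : T) :
  nat -> nat -> T := upd f a (upd (f a) i v).

(** Structured control flow, shared by the two machines below.  The machine
    states [S] contain a [store], accessed by [view], on which all tests are
    evaluated: a test succeeds when its value is nonzero.  [exec] is partial. *)
Inductive cmd (I : Type) :=
| Skip
| Instr of I
| Seq of cmd I & cmd I
| If of expr & cmd I & cmd I
| While of expr & cmd I.

Arguments Skip {I}.

Section Run.

Variables (S I : Type) (view : S -> store).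
Variables (exec : S -> I -> option S).
Variables (icost : S -> I -> nat) (tcost : store -> expr -> nat).

(** [run c s t s']: started in [s], [c] halts in [s'] after time [t]. *)
Inductive run : cmd I -> S -> nat -> S -> Prop :=
| run_skip s :
    run Skip s 0 s
| run_instr i s s' :
    exec s i = Some s' -> run (Instr i) s (icost s i) s'
| run_seq c1 c2 s1 s2 s3 t1 t2 :
    run c1 s1 t1 s2 -> run c2 s2 t2 s3 -> run (Seq c1 c2) s1 (t1 + t2) s3
| run_if_true b c1 c2 s s' t :
    eval (view s) b != 0 -> run c1 s t s' ->
    run (If b c1 c2) s (tcost (view s) b + t) s'
| run_if_false b c1 c2 s s' t :
    eval (view s) b = 0 -> run c2 s t s' ->
    run (If b c1 c2) s (tcost (view s) b + t) s'
| run_while_true b c s1 s2 s3 t1 t2 :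
    eval (view s1) b != 0 -> run c s1 t1 s2 -> run (While b c) s2 t2 s3 ->
    run (While b c) s1 (tcost (view s1) b + t1 + t2) s3
| run_while_false b c s :
    eval (view s) b = 0 -> run (While b c) s (tcost (view s) b) s.

End Run.

Inductive instr :=
| Assign of nat & expr
| Write of nat & expr & expr.

Definition step (s : store) (i : instr) : store :=
  match i with
  | Assign x e => Store (upd (var s) x (eval s e)) (arr s)
  | Write a j e => Store (var s) (upd2 (arr s) a (eval s j) (eval s e))
  end.

(** The logarithmic cost criterion of Aho, Hopcroft and Ullman: every operation
    is charged the bit lengths of its operands, an indirect access those of the
    address and of the content.  [0] has length [1]. *)
Definition bitlen (m : nat) : nat := (trunc_log 2 m).+1.

Fixpoint expr_cost (s : store) (e : expr) : nat :=
  match e with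
  | Const c => bitlen c
  | Var x => bitlen (var s x)
  | Read a i => expr_cost s i + bitlen (eval s i) + bitlen (eval s e)
  | Op _ e1 e2 =>
      expr_cost s e1 + expr_cost s e2 + bitlen (eval s e1) + bitlen (eval s e2)
  end.

Definition instr_cost (s : store) (i : instr) : nat :=
  match i with
  | Assign _ e => expr_cost s e + bitlen (eval s e)
  | Write _ j e =>
      expr_cost s j + expr_cost s e + bitlen (eval s j) + bitlen (eval s e)
  end.

Definition ram_prog := cmd instr.

Definition ram_run : ram_prog -> store -> nat -> store -> Prop :=
  run id (fun s i => Some (step s i)) instr_cost expr_cost.

(** The machine on which the arithmetic complexity of matrix multiplication is
    measured.  Matrix entries are integers kept in separate arrays; they can be
    added, subtracted and multiplied, but neither tested nor used as indices.
    Every instruction and every test takes unit time (a fixed program has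
    expressions of bounded size). *)
Inductive rexpr :=
| RConst of int
| RRead of nat & expr
| RAdd of rexpr & rexpr
| RSub of rexpr & rexpr
| RMul of rexpr & rexpr.

Inductive ainstr :=
| Idx of instr
| RWrite of nat & expr & rexpr.

Record astore := AStore { idx : store; entry : nat -> nat -> int }.

Fixpoint reval (s : astore) (e : rexpr) : int :=
  match e with
  | RConst z => z
  | RRead a i => entry s a (eval (idx s) i)
  | RAdd e1 e2 => (reval s e1 + reval s e2)%R
  | RSub e1 e2 => (reval s e1 - reval s e2)%R
  | RMul e1 e2 => (reval s e1 * reval s e2)%R
  end.

Definition written (s : store) (i : instr) : nat :=
  match i with Assign _ e => eval s e | Write _ _ e => eval s e end.

(** Since index operations have unit cost, indices are machine words: the
    machine gets stuck when a number exceeding [cap] is stored.  (Values of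
    subexpressions are then polynomial in [cap], expressions being fixed.) *)
Definition astep (cap : nat) (s : astore) (i : ainstr) : option astore :=
  match i with
  | Idx j =>
      if written (idx s) j <= cap
      then Some (AStore (step (idx s) j) (entry s)) else None
  | RWrite a j e =>
      Some (AStore (idx s) (upd2 (entry s) a (eval (idx s) j) (reval s e)))
  end.

Definition arith_prog := cmd ainstr.

Definition arith_run (cap : nat) : arith_prog -> astore -> nat -> astore -> Prop :=
  run idx (astep cap) (fun _ _ => 1) (fun _ _ => 1).

(** Row-major layout of an [n * n] array; [z] outside. *)
Definition flat (T : Type) (n : nat) (z : T) (f : 'I_n -> 'I_n -> T) (p : nat) : T :=
  if insub (p %/ n) is Some i then
    if insub (p %% n) is Some j then f i j else z
  else z.

Definition matmul_input (n : nat) (A B : 'M[int]_n) : astore :=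
  AStore (Store (upd (fun _ => 0) 0 n) (fun _ _ => 0))
    (fun a => if a == 0 then flat 0%R A
              else if a == 1 then flat 0%R B else fun _ => 0%R).

(** Two [n * n] matrices can be multiplied in time [O(n ^ omega)], by one
    program for all [n], with words of [O(log n)] bits. *)
Definition matmul_in_time (R : realType) (omega : R) : Prop :=
  exists (P : arith_prog) (C : R) (c d : nat),
    forall (n : nat) (A B : 'M[int]_n), 0 < n ->
    exists (t : nat) (s : astore),
      [/\ arith_run (c * n ^ d) P (matmul_input A B) t s,
          forall i j : 'I_n, entry s 2 (i * n + j) = (A *m B)%R i j
        & (t%:R <= C * n%:R `^ omega)%R].

Section Graph.

Variables (n : nat) (e : rel 'I_n) (w : 'I_n -> 'I_n -> nat).

(** [c] lists the vertices of a closed walk; its last edge leads back to the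
    head of [c], so that there are [size c] edges. *)
Definition cycle_weight (c : seq 'I_n) : nat :=
  \sum_(p <- zip c (rot 1 c)) w p.1 p.2.

Definition cycle_mean (R : realType) (c : seq 'I_n) : R :=
  ((cycle_weight c)%:R / (size c)%:R)%R.

Definition reachable_cycle (x : 'I_n) (c : seq 'I_n) : Prop :=
  [/\ c != [::], cycle e c & has (connect e x) c].

Definition min_cycle_mean (R : realType) (x : 'I_n) (m : R) : Prop :=
  (exists2 c, reachable_cycle x c & cycle_mean R c = m) /\
  (forall c, reachable_cycle x c -> m <= cycle_mean R c)%R.

Definition max_weight : nat := \max_(p : 'I_n * 'I_n | e p.1 p.2) w p.1 p.2.

(** The real number [eps] in [(0, 1]] is presented by its binary expansion:
    cell [k] of array [2] is the digit of weight [2 ^ - k]. *)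
Definition graph_input (R : realType) (eps : R) : store :=
  Store (upd (fun _ => 0) 0 n)
    (fun a => if a == 0 then flat 0 (fun i j => nat_of_bool (e i j))
              else if a == 1 then flat 0 (fun i j => if e i j then w i j else 0)
              else if a == 2 then fun k => Num.truncn (eps * 2 ^+ k)%R %% 2
              else fun _ => 0).

End Graph.

(** A rational output value is a numerator in array [3] and a nonzero
    denominator in array [4]. *)
Definition output (R : realType) (s : store) (x : nat) : R :=
  ((arr s 3 x)%:R / (arr s 4 x)%:R)%R.

(** Binary logarithm in running times, read as at least [1] so that the bounds
    make sense for all values of the parameters. *)
Definition lg (R : realType) (x : R) : R := Num.max 1%R (ln x / ln 2)%R.

(* Main.v *)
Require Import Defs.
From mathcomp Require Import all_boot all_order all_algebra.
From mathcomp Require Import reals exp.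
From mathcomp Require Import boolp zify ring lra.

Set Implicit Arguments.
Unset Strict Implicit.
Unset Printing Implicit Defensive.

Import Order.TTheory GRing.Theory Num.Theory.

(** All distances are kept as integers, and on the RAM a product costs only the
    length of its factors; this makes a single, purely arithmetic scheme fit
    both time bounds.

    Let [W > 0] be the largest weight, [E] the power of two with
    [1 <= eps * E <= 2], and [T = 2 ^ K >= 16 n ^ 2 W E].  A walk with [T] edges
    from [x] weighs at least [(T - n) mu(x)], since cutting out short cycles
    leaves fewer than [n] edges, and the lightest one weighs at most
    [T mu(x) + 2 n W].  So its weight divided by [T - n] approximates [mu(x)],
    which is either [0] or at least [1 / n].

    The weights of lightest walks with [2 ^ i] edges are obtained by [K]
    approximate min-plus squarings.  In a squaring the entries are rounded down
    to multiples of [s = 2 ^ j], for each of [2 K] scales, and [a <= r s] is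
    encoded as [(n + 1) ^ (r - a / s)]; the integer product of the encoded
    matrices reveals the min-plus product up to [2 s].  The finest scale whose
    result is at most [r] has relative error [4 / r], and [r >= 16 K E] keeps
    the total error below [1 / (4 E)].  Each of the [2 K ^ 2] matrix products
    handles numbers of [O(r log n)] bits, whence the time
    [O(n ^ omega * K ^ 2 * (K / eps) * log n)] with [K = O(log (n W / eps))]. *)

(** * A Hoare logic with costs for the RAM *)

(** The multiplication program is only assumed to work over the integers at unit cost, so its
    intermediate entries may be arbitrarily long. But it can neither test entries nor use them as
    addresses: its control flow survives reduction of every entry modulo [M], a number above all
    entries of the encoded products. Hence one bound [B] covers all of memory, and it suffices to
    count steps, each costing [bitlen B] up to a constant factor.

    All rounding is downwards, so a recorded distance never exceeds a true one. The losses are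
    undone once, by the denominator [(r - 4 * K) * (T - n)], which makes the output an upper bound
    for [mu]. A remaining additive error would be fatal for [mu = 0]; a distance of at most
    [2 * n * W] occurs exactly in that case and is answered by 0. Otherwise [mu] is at least
    [1 / n], which absorbs the error into the ratio.

    [T], [r] and the scales are powers of two, so that squarings produce every power of [n + 1] and
    exponents can be read off in binary. The factor [lg (L / eps) ^+ 2] is at least 1 and is never
    spent: one estimate gives both time bounds. *)

Lemma bitlen_leq m n : m <= n -> bitlen m <= bitlen n.
Proof. by move=> le_mn; rewrite ltnS leq_trunc_log. Qed.

Lemma bitlen_expn m b : m < 2 ^ b -> 0 < b -> bitlen m <= b.
Proof.
move=> lt_mb b_gt0; case: m lt_mb => [|m] lt_mb; first by rewrite /bitlen.
by rewrite /bitlen -(ltn_exp2l _ _ (ltnSn 1)) (leq_ltn_trans _ lt_mb) ?trunc_logP.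
Qed.

Lemma ltn_bitlen m : m < 2 ^ bitlen m.
Proof. exact: trunc_log_ltn. Qed.

Lemma bitlenM m n : bitlen (m * n) <= bitlen m + bitlen n.
Proof.
apply: bitlen_expn; last by rewrite addnS.
have := ltn_bitlen m; have := ltn_bitlen n; rewrite expnD; nia.
Qed.

Lemma bitlenD m n : bitlen (m + n) <= bitlen m + bitlen n.
Proof.
apply: bitlen_expn; last by rewrite addnS.
have ltm := ltn_bitlen m; have ltn := ltn_bitlen n; rewrite expnD.
have: 1 < 2 ^ bitlen m by rewrite -[1%N]/(2 ^ 0)%N ltn_exp2l.
have: 1 < 2 ^ bitlen n by rewrite -[1%N]/(2 ^ 0)%N ltn_exp2l.
nia.
Qed.

Lemma bitlenX m k : bitlen (m ^ k) <= k * bitlen m + 1.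
Proof.
elim: k => [|k IHk]; first by rewrite expn0 mul0n.
by rewrite expnS mulSn -addnA (leq_trans (bitlenM _ _)) // leq_add2l.
Qed.

Definition sbound (B : nat) (s : store) : Prop :=
  (forall x, var s x <= B) /\ (forall a i, arr s a i <= B).

(** Relative to the bit length of a bound on the memory contents, an expression
    has values of length [esize], costs [ecost], and its commands [csize] per
    execution of each part. *)
Fixpoint esize (e : expr) : nat :=
  match e with
  | Const c => bitlen c
  | Var _ | Read _ _ => 1
  | Op _ e1 e2 => esize e1 + esize e2
  end.

Fixpoint ecost (e : expr) : nat :=
  match e with
  | Const c => bitlen c
  | Var _ => 1
  | Read _ i => ecost i + esize i + 1
  | Op _ e1 e2 => ecost e1 + ecost e2 + esize e1 + esize e2
  end.

Definition isize (i : instr) : nat :=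
  match i with
  | Assign _ e => ecost e + esize e
  | Write _ j e => ecost j + ecost e + esize j + esize e
  end.

Fixpoint csize (c : ram_prog) : nat :=
  match c with
  | Skip => 0
  | Instr i => isize i
  | Seq c1 c2 => csize c1 + csize c2
  | If b c1 c2 => ecost b + csize c1 + csize c2
  | While b c => ecost b + csize c
  end.

Lemma eval_bitlen B s e : sbound B s -> bitlen (eval s e) <= esize e * bitlen B.
Proof.
move=> [bv ba]; elim: e => [c|x|a i _|o e1 IH1 e2 IH2] /=.
- by rewrite leq_pmulr.
- by rewrite mul1n; apply: bitlen_leq.
- by rewrite mul1n; apply: bitlen_leq.
rewrite mulnDl; apply: leq_trans (leq_add IH1 IH2).
case: o => /=; [exact: bitlenD| | exact: bitlenM |].
- by apply: leq_trans (leq_addr _ _); rewrite bitlen_leq ?leq_subr.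
- by apply: leq_trans (leq_addr _ _); rewrite bitlen_leq ?leq_div.
Qed.

Lemma expr_cost_le B s e : sbound B s -> expr_cost s e <= ecost e * bitlen B.
Proof.
move=> bs; have le_e := (fun e => eval_bitlen e bs).
elim: e => [c|x|a i IHi|o e1 IH1 e2 IH2] /=.
- by rewrite leq_pmulr.
- by case: bs => bv _; rewrite mul1n; apply: bitlen_leq.
- by rewrite !mulnDl !leq_add // mul1n; case: bs => _ ba; rewrite bitlen_leq.
- by rewrite !mulnDl !leq_add.
Qed.

Lemma instr_cost_le B s i : sbound B s -> instr_cost s i <= isize i * bitlen B.
Proof.
move=> bs; have le_e := (fun e => eval_bitlen e bs).
have le_c := (fun e => expr_cost_le e bs).
by case: i => [x e|a j e] /=; rewrite !mulnDl !leq_add.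
Qed.

Lemma sbound_step B s i : sbound B s -> written s i <= B -> sbound B (step s i).
Proof.
move=> [bv ba]; case: i => [x e|a j e] /= le_B; split=> //.
- by move=> y /=; rewrite /upd; case: ifP.
- by move=> a' i' /=; rewrite /upd2 /upd; case: ifP => // _; case: ifP.
Qed.

(** Total correctness. The memory bound is an invariant built into every triple, so that [N] is a
    pure count, independent of the numbers handled. *)
Definition tri (B : nat) (c : ram_prog) (s : store) (N : nat)
    (Q : store -> Prop) : Prop :=
  sbound B s -> exists t s',
    [/\ ram_run c s t s', t <= N * bitlen B, sbound B s' & Q s'].

(** A syntactic over-approximation of what a command may change. Through [run_agree] it supplies the
    frame conditions, and loop invariants need only speak of what the loop alters. *)
Fixpoint modv (c : ram_prog) : seq nat :=
  match c with
  | Instr (Assign x _) => [:: x]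
  | Seq c1 c2 | If _ c1 c2 => modv c1 ++ modv c2
  | While _ c => modv c
  | _ => [::]
  end.

Fixpoint moda (c : ram_prog) : seq nat :=
  match c with
  | Instr (Write a _ _) => [:: a]
  | Seq c1 c2 | If _ c1 c2 => moda c1 ++ moda c2
  | While _ c => moda c
  | _ => [::]
  end.

Definition agree (c : ram_prog) (s s' : store) : Prop :=
  (forall x, x \notin modv c -> var s' x = var s x) /\
  (forall a, a \notin moda c -> arr s' a = arr s a).

Lemma agree_trans c s1 s2 s3 : agree c s1 s2 -> agree c s2 s3 -> agree c s1 s3.
Proof.
move=> [v12 a12] [v23 a23]; split=> [x x_c|a a_c].
- by rewrite v23 ?v12.
- by rewrite a23 ?a12.
Qed.

Lemma agree_sub c c' s s' : {subset modv c <= modv c'} ->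
  {subset moda c <= moda c'} -> agree c s s' -> agree c' s s'.
Proof.
move=> sv sa [v a]; split=> [x /negP x_c|b /negP b_c].
- by rewrite v //; apply/negP => /sv.
- by rewrite a //; apply/negP => /sa.
Qed.

Lemma run_agree c0 s0 t0 s0' : ram_run c0 s0 t0 s0' -> agree c0 s0 s0'.
Proof.
elim=> {c0 s0 t0 s0'}.
- by [].
- move=> [x e|a j e] s s' [<-]; split=> //=.
  + by move=> y; rewrite inE /upd => /negPf ->.
  + by move=> b; rewrite inE /upd2 /upd => /negPf ->.
- move=> c1 c2 s1 s2 s3 t1 t2 _ IH1 _ IH2.
  by apply: agree_trans (agree_sub _ _ IH1) (agree_sub _ _ IH2) => /= z;
    rewrite mem_cat => ->; rewrite ?orbT.
- move=> b c1 c2 s s' t _ _; apply: agree_sub => /= z;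
  by rewrite mem_cat => ->.
- move=> b c1 c2 s s' t _ _; apply: agree_sub => /= z;
  by rewrite mem_cat => ->; rewrite orbT.
- by move=> b c s1 s2 s3 t1 t2 _ _ IH1 _; apply: agree_trans.
- by [].
Qed.

Section Rules.

Variable B : nat.

Implicit Types (c : ram_prog) (s : store) (Q : store -> Prop).

Lemma tri_mono c s N N' Q Q' : tri B c s N Q -> N <= N' ->
  (forall s', Q s' -> Q' s') -> tri B c s N' Q'.
Proof.
move=> tc le_N QQ' /tc[t [s' [r le_t bs' /QQ' q]]]; exists t, s'; split=> //.
by apply: leq_trans le_t _; rewrite leq_mul2r le_N orbT.
Qed.

Lemma tri_post c s N Q Q' :
  tri B c s N Q -> (forall s', Q s' -> Q' s') -> tri B c s N Q'.
Proof. by move=> tc; apply: tri_mono tc _. Qed.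

Lemma tri_agree c s N Q :
  tri B c s N Q -> tri B c s N (fun s' => agree c s s' /\ Q s').
Proof.
move=> tc /tc[t [s' [r le_t bs' q]]]; exists t, s'; split=> //; split=> //.
exact: run_agree r.
Qed.

Lemma tri_seq c1 c2 s N1 N2 Q :
  tri B c1 s N1 (fun s' => tri B c2 s' N2 Q) -> tri B (Seq c1 c2) s (N1 + N2) Q.
Proof.
move=> tc /tc[t1 [s1 [r1 le1 b1 /(_ b1) [t2 [s2 [r2 le2 b2 q]]]]]].
exists (t1 + t2), s2; split=> //; first exact: run_seq r1 r2.
by rewrite mulnDl leq_add.
Qed.

Lemma tri_if b c1 c2 s N Q :
  (eval s b != 0 -> tri B c1 s N Q) -> (eval s b = 0 -> tri B c2 s N Q) ->
  tri B (If b c1 c2) s (ecost b + N) Q.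
Proof.
move=> tc1 tc2 bs; have le_b := expr_cost_le b bs.
have [b0|b0] := eqVneq (eval s b) 0.
- have [t [s' [r le_t bs' q]]] := tc2 b0 bs.
  exists (expr_cost s b + t), s'; split=> //; first exact: run_if_false.
  by rewrite mulnDl leq_add.
- have [t [s' [r le_t bs' q]]] := tc1 b0 bs.
  exists (expr_cost s b + t), s'; split=> //; first exact: run_if_true.
  by rewrite mulnDl leq_add.
Qed.

(** Meant for loop-free code only, whence [False] for [While]; loops are treated by [tri_while] and
    [tri_for]. *)
Fixpoint wp (c : ram_prog) s Q : Prop :=
  match c with
  | Skip => Q s
  | Instr i => written s i <= B /\ Q (step s i)
  | Seq c1 c2 => wp c1 s (fun s1 => wp c2 s1 Q)
  | If b c1 c2 => (eval s b != 0 -> wp c1 s Q) /\ (eval s b = 0 -> wp c2 s Q)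
  | While _ _ => False
  end.

Lemma wp_tri c s Q : wp c s Q -> tri B c s (csize c) Q.
Proof.
elim: c s Q => [|i|c1 IH1 c2 IH2|b c1 IH1 c2 IH2|//] s Q /=.
- by move=> q bs; exists 0, s; split=> //; exact: run_skip.
- move=> [le_B q] bs; exists (instr_cost s i), (step s i); split=> //.
  + exact: run_instr.
  + exact: instr_cost_le.
  + exact: sbound_step.
- move=> q; apply: tri_seq; apply: tri_mono (IH1 _ _ q) (leqnn _) _ => s' q'.
  exact: IH2.
- move=> [q1 q2]; rewrite -addnA; apply: tri_if => b0.
  + by apply: tri_mono (IH1 _ _ (q1 b0)) (leq_addr _ _) _.
  + by apply: tri_mono (IH2 _ _ (q2 b0)) (leq_addl _ _) _.
Qed.

Lemma tri_seq_wp c1 c2 s N Q :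
  wp c1 s (fun s' => tri B c2 s' N Q) -> tri B (Seq c1 c2) s (csize c1 + N) Q.
Proof. by move=> q; apply: tri_seq; apply: wp_tri. Qed.

Lemma tri_seq_agree c1 c2 s N1 N2 Q1 Q : tri B c1 s N1 Q1 ->
  (forall s', agree c1 s s' -> Q1 s' -> tri B c2 s' N2 Q) ->
  tri B (Seq c1 c2) s (N1 + N2) Q.
Proof.
move=> /tri_agree tc1 tc2; apply: tri_seq; apply: tri_mono tc1 (leqnn _) _ => s'.
by move=> [ag q1]; apply: tc2.
Qed.

Lemma tri_while b c s m N (I : nat -> store -> Prop) :
  I 0 s ->
  (forall i s', i < m -> agree (While b c) s s' -> sbound B s' -> I i s' ->
    eval s' b != 0 /\ tri B c s' N (I i.+1)) ->
  (forall s', agree (While b c) s s' -> sbound B s' -> I m s' -> eval s' b = 0) ->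
  tri B (While b c) s (m * (ecost b + N) + ecost b) (I m).
Proof.
move=> I0 Istep Iend.
(* Induction on the number [k] of iterations still to come; [m - k] are done. *)
suff gen k s' : k <= m -> agree (While b c) s s' -> I (m - k) s' ->
    tri B (While b c) s' (k * (ecost b + N) + ecost b) (I m).
  by apply: gen => //; rewrite subnn.
elim: k s' => [|k IHk] s' le_k ag.
  rewrite subn0 => Im bs; exists (expr_cost s' b), s'; split=> //.
  + by apply: run_while_false; exact: Iend.
  + exact: expr_cost_le.
move=> Ik bs; have [|b1 tc] := Istep _ s' _ ag bs Ik; first by lia.
have [t1 [s1 [r1 le1 bs1]]] := tc bs.
have -> : (m - k.+1).+1 = m - k by lia.
move=> I1; have ag1 : agree (While b c) s s1.
  by apply: agree_trans ag _; exact: run_agree r1.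
have [t2 [s2 [r2 le2 bs2 q]]] := IHk s1 (ltnW le_k) ag1 I1 bs1.
exists (expr_cost s' b + t1 + t2), s2; split=> //; first exact: run_while_true r1 r2.
have := expr_cost_le b bs; rewrite mulSn -addnA !mulnDl; lia.
Qed.

(** A truncated difference [y - x] is nonzero exactly when [x < y]; the comparisons of the program
    are all written in this way. *)
Definition For (x y : nat) c : ram_prog :=
  Seq (Instr (Assign x (Const 0)))
      (While (Op Defs.Sub (Var y) (Var x))
             (Seq c (Instr (Assign x (Op Add (Var x) (Const 1)))))).

Definition setv s x v := Store (upd (var s) x v) (arr s).

(* [40] dominates the cost of handling the counter. *)
Lemma tri_for x y c s m N (I : nat -> store -> Prop) :
  var s y = m -> m <= B -> x != y -> x \notin modv c -> y \notin modv c ->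
  I 0 (setv s x 0) ->
  (forall i s', i < m -> agree (For x y c) s s' -> var s' x = i ->
     sbound B s' -> I i s' ->
     tri B c s' N (fun s'' => I i.+1 (setv s'' x i.+1))) ->
  tri B (For x y c) s (m * (N + 40) + 40) (fun s' => I m s' /\ var s' x = m).
Proof.
move=> ym le_mB xy xc yc I0 Istep.
pose J i s' := I i s' /\ var s' x = i.
have agF s' : agree (For x y c) s s' -> var s' y = m.
  move=> [v _]; rewrite v //= inE mem_cat inE.
  by rewrite negb_or (negPf yc) eq_sym xy.
have ag0 : agree (For x y c) s (setv s x 0).
  by split=> //= z; rewrite !inE /upd => /norP[/negPf -> _].
have agW s' : agree (While (Op Defs.Sub (Var y) (Var x))
             (Seq c (Instr (Assign x (Op Add (Var x) (Const 1)))))) (setv s x 0) s' ->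
     agree (For x y c) s s'.
  move=> ag; apply: agree_trans ag0 _; apply: agree_sub ag => z //= z_in.
  by rewrite inE z_in orbT.
pose c1 : ram_prog := Instr (Assign x (Op Add (Var x) (Const 1))).
pose b := Op Defs.Sub (Var y) (Var x).
have tc : tri B (For x y c) s (csize (Instr (Assign x (Const 0))) +
    (m * (ecost b + (N + csize c1)) + ecost b)) (J m).
  apply: tri_seq.
  apply: (tri_mono (@wp_tri _ _ (eq (setv s x 0)) _) (leqnn _)) => //=.
  move=> _ <-; apply: tri_while.
  - by split=> //; rewrite /= /upd eqxx.
  - move=> i s' lt_im /agW ag bs [Ii xi].
    split; first by rewrite /= (agF _ ag) xi; lia.
    apply: tri_seq; have := Istep i s' lt_im ag xi bs Ii.
    move=> /tri_agree tc; apply: (tri_mono tc) => // s'' [[v _] Ii1].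
    apply: wp_tri => /=; rewrite v // xi addn1; split; first by lia.
    by split=> //=; rewrite /upd eqxx.
  - by move=> s' /agW ag bs [_ xm]; rewrite /= (agF _ ag) xm subnn.
apply: (tri_mono tc) => //.
have bl0 : bitlen 0 = 1 by []. have bl1 : bitlen 1 = 1 by [].
by rewrite /= bl0 bl1; nia.
Qed.

End Rules.

(** * Running the matrix multiplication program on the RAM *)

(** Cell [i] of the simulated memory sits at address [i * G + g] in its array,
    where [G] is in variable [10] and [g], the number of the current call, in
    variable [11]: each call thus starts with fresh memory.  Simulated scalars
    are in array [10]; matrix entries are reduced modulo variable [9]. *)
Definition addr (e : expr) : expr := Op Add (Op Mul e (Var 10)) (Var 11).

Fixpoint sexpr (e : expr) : expr :=
  match e with
  | Const c => Const c
  | Var x => Read 10 (addr (Const x))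
  | Read a i => Read (a.*2 + 11) (addr (sexpr i))
  | Op o e1 e2 => Op o (sexpr e1) (sexpr e2)
  end.

(** Subtraction is multiplication by [M - 1] modulo [M]. *)
Definition negmod (e : expr) : expr := Op Mul e (Op Defs.Sub (Var 9) (Const 1)).

(** Reduction modulo [M] happens only on writing. Inside an expression values may grow, but their
    length stays within a constant factor, the expression being fixed. *)
Fixpoint srexpr (e : rexpr) : expr :=
  match e with
  | RConst (Posz m) => Const m
  | RConst (Negz m) => negmod (Const m.+1)
  | RRead a i => Read (a.*2 + 12) (addr (sexpr i))
  | RAdd e1 e2 => Op Add (srexpr e1) (srexpr e2)
  | RSub e1 e2 => Op Add (srexpr e1) (negmod (srexpr e2))
  | RMul e1 e2 => Op Mul (srexpr e1) (srexpr e2)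
  end.

(** Odd array numbers from 11 hold index arrays and even ones from 12 hold matrix entries, so both
    avoid each other, the scalars in array 10 and the arrays below 10 of the calling program. *)
Definition sinstr (i : ainstr) : instr :=
  match i with
  | Idx (Assign x e) => Write 10 (addr (Const x)) (sexpr e)
  | Idx (Write a j e) => Write (a.*2 + 11) (addr (sexpr j)) (sexpr e)
  | RWrite a j e => Write (a.*2 + 12) (addr (sexpr j))
      (Op Defs.Sub (srexpr e) (Op Mul (Op Div (srexpr e) (Var 9)) (Var 9)))
  end.

Fixpoint scmd (c : arith_prog) : ram_prog :=
  match c with
  | Skip => Skip
  | Instr i => Instr (sinstr i)
  | Seq c1 c2 => Seq (scmd c1) (scmd c2)
  | If b c1 c2 => If (sexpr b) (scmd c1) (scmd c2)
  | While b c => While (sexpr b) (scmd c)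
  end.

Section Simulation.

Variables (B G g M : nat).
Hypotheses (lt_gG : g < G) (M_gt0 : 0 < M) (le_MB : M <= B).

(** Index memory is represented exactly, entries only modulo [M]. Tests and addresses depend on
    index memory alone, so both machines follow the same path. *)
Record sim (s : store) (a : astore) : Prop := Sim {
  sim_M : var s 9 = M;
  sim_G : var s 10 = G;
  sim_g : var s 11 = g;
  sim_var : forall x, arr s 10 (x * G + g) = var (idx a) x;
  sim_arr : forall b i, arr s (b.*2 + 11) (i * G + g) = arr (idx a) b i;
  sim_lt : forall b i, arr s (b.*2 + 12) (i * G + g) < M;
  sim_entry : forall b i, exists k : int,
    entry a b i = ((arr s (b.*2 + 12) (i * G + g))%:Z + k * M%:Z)%R }.

(** Finer than [agree]: calls share the arrays from 10 on, and only the residue of an address modulo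
    [G] tells them apart. *)
Definition outside (s s' : store) : Prop :=
  var s' = var s /\
  forall b i, (b < 10) || (i %% G != g) -> arr s' b i = arr s b i.

Lemma outside_trans s1 s2 s3 : outside s1 s2 -> outside s2 s3 -> outside s1 s3.
Proof.
by move=> [v12 a12] [v23 a23]; split=> [|b i bi]; rewrite ?v23 // a23 ?a12.
Qed.

Lemma eq_addr i j : (i * G + g == j * G + g) = (i == j).
Proof. by rewrite eqn_add2r eqn_pmul2r //; case: (G) lt_gG. Qed.

Lemma sexpr_eval s a e : sim s a -> eval s (sexpr e) = eval (idx a) e.
Proof.
move=> sa; elim: e => //= [x|b i ->|o e1 -> e2 ->] //.
- by rewrite (sim_G sa) (sim_g sa) (sim_var sa).
- by rewrite (sim_G sa) (sim_g sa) (sim_arr sa).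
Qed.

Lemma srexpr_eval s a e : sim s a ->
  exists k : int, reval a e = ((eval s (srexpr e))%:Z + k * M%:Z)%R.
Proof.
move=> sa; elim: e => [[m|m]|b i|e1 [k1 IH1] e2 [k2 IH2]|e1 [k1 IH1] e2 [k2 IH2]
  |e1 [k1 IH1] e2 [k2 IH2]] /=.
- by exists 0%R; rewrite mul0r addr0.
- by rewrite (sim_M sa); exists (- (m.+1)%:Z)%R; nia.
- rewrite (sim_G sa) (sim_g sa) (sexpr_eval _ sa).
  by have [k ->] := sim_entry sa b (eval (idx a) i); exists k.
- by exists (k1 + k2)%R; rewrite IH1 IH2; lia.
- exists (k1 + k2 * 1 - (eval s (srexpr e2))%:Z - k2 * 2)%R.
  by rewrite IH1 IH2 (sim_M sa) PoszD PoszM -subzn //; ring.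
- exists (k1 * (eval s (srexpr e2))%:Z + (eval s (srexpr e1))%:Z * k2 + k1 * k2 * M%:Z)%R.
  by rewrite IH1 IH2 PoszM; ring.
Qed.

Lemma upd2E (T : Type) (f : nat -> nat -> T) a i v b j :
  upd2 f a i v b j = if (b == a) && (j == i) then v else f b j.
Proof. by rewrite /upd2 /upd; case: eqP => //= ->. Qed.

Lemma outside_write s b i v : 10 <= b ->
  outside s (Store (var s) (upd2 (arr s) b (i * G + g) v)).
Proof.
move=> b10; split=> //= b' j; rewrite upd2E; case: andP => // -[/eqP-> /eqP->].
by rewrite ltnNge b10 modnMDl modn_small // eqxx.
Qed.

Lemma sim_step cap s a i a' : cap <= B -> astep cap a i = Some a' ->
  sim s a -> 
  [/\ written s (sinstr i) <= B, sim (step s (sinstr i)) a'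
    & outside s (step s (sinstr i))].
Proof.
move=> le_cap; case: i => [[x e|b j e]|b j e] /=.
- case: ifP => // le_e [<-] sa.
  rewrite (sim_G sa) (sim_g sa) (sexpr_eval _ sa).
  split; [exact: leq_trans le_cap | | exact: outside_write].
  case: sa => sM sG sg sv sr sl se; split=> //= [y|b i|b i|b i]; rewrite !upd2E /=.
  + by rewrite eq_addr /upd sv.
  + by case: eqP => [|_] /=; [lia | exact: sr].
  + by case: eqP => [|_] /=; [lia | exact: sl].
  + by case: eqP => [|_] /=; [lia | exact: se].
- case: ifP => // le_e [<-] sa.
  rewrite (sim_G sa) (sim_g sa) !(sexpr_eval _ sa).
  split; [exact: leq_trans le_cap | | by apply: outside_write; lia].
  case: sa => sM sG sg sv sr sl se; split=> //= [y|c i|c i|c i]; rewrite !upd2E /=.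
  + by case: eqP => [|_] /=; [lia | exact: sv].
  + rewrite eqn_add2r (inj_eq double_inj) eq_addr sr; by case: ifP.
  + by case: eqP => [|_] /=; [lia | exact: sl].
  + by case: eqP => [|_] /=; [lia | exact: se].
- move=> [<-] sa; rewrite (sim_G sa) (sim_g sa) (sim_M sa) (sexpr_eval _ sa).
  set u := eval s (srexpr e).
  have ltu : u - u %/ M * M < M by rewrite {1}(divn_eq u M) addKn ltn_pmod.
  have [k ek] := srexpr_eval e sa.
  split; [by apply: leq_trans (ltnW ltu) _ | | by apply: outside_write; lia].
  case: sa => sM sG sg sv sr sl se; split=> //= [y|c i|c i|c i]; rewrite !upd2E /=.
  + by case: eqP => [|_] /=; [lia | exact: sv].
  + by case: eqP => [|_] /=; [lia | exact: sr].
  + by case: ifP.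
  + rewrite eqn_add2r (inj_eq double_inj) eq_addr.
    case: ifP => [_|_]; last exact: se.
    exists (k + (u %/ M)%:Z)%R; rewrite ek -/u -subzn ?leq_trunc_div // PoszM.
    by ring.
Qed.

(** Each unit-time step becomes one instruction or test of a fixed RAM program, which costs at most
    [csize (scmd c)] times [bitlen B]. *)
Lemma sim_run cap c a t a' s : cap <= B ->
  arith_run cap c a t a' -> sim s a -> sbound B s ->
  exists tm s', [/\ ram_run (scmd c) s tm s',
    tm <= csize (scmd c) * t * bitlen B, sbound B s', sim s' a' & outside s s'].
Proof.
move=> le_cap r; elim: r s => {c a t a'}.
- move=> a s sa bs; exists 0, s; split=> //; exact: run_skip.
- move=> i a a' st s sa bs; have [wr sa' out] := sim_step le_cap st sa.
  exists (instr_cost s (sinstr i)), (step s (sinstr i)); split=> //.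
  + exact: run_instr.
  + by rewrite muln1; apply: instr_cost_le.
  + exact: sbound_step.
- move=> c1 c2 a1 a2 a3 t1 t2 _ IH1 _ IH2 s sa bs.
  have [m1 [s1 [r1 l1 b1 sa1 o1]]] := IH1 s sa bs.
  have [m2 [s2 [r2 l2 b2 sa2 o2]]] := IH2 s1 sa1 b1.
  exists (m1 + m2), s2; split=> //; [exact: run_seq r1 r2| |exact: outside_trans o1 o2].
  apply: leq_trans (leq_add l1 l2) _; rewrite -mulnDl leq_mul2r /=.
    nia.
- move=> b c1 c2 a a' t eb _ IH s sa bs.
  have [m1 [s1 [r1 l1 b1 sa1 o1]]] := IH s sa bs.
  exists (expr_cost s (sexpr b) + m1), s1; split=> //.
  + by apply: run_if_true => //; rewrite (sexpr_eval _ sa).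
  + apply: leq_trans (leq_add (expr_cost_le _ bs) l1) _.
    by rewrite -mulnDl leq_mul2r /=; nia.
- move=> b c1 c2 a a' t eb _ IH s sa bs.
  have [m1 [s1 [r1 l1 b1 sa1 o1]]] := IH s sa bs.
  exists (expr_cost s (sexpr b) + m1), s1; split=> //.
  + by apply: run_if_false => //; rewrite (sexpr_eval _ sa).
  + apply: leq_trans (leq_add (expr_cost_le _ bs) l1) _.
    by rewrite -mulnDl leq_mul2r /=; nia.
- move=> b c a1 a2 a3 t1 t2 eb _ IH1 _ IH2 s sa bs.
  have [m1 [s1 [r1 l1 b1 sa1 o1]]] := IH1 s sa bs.
  have [m2 [s2 [r2 l2 b2 sa2 o2]]] := IH2 s1 sa1 b1.
  exists (expr_cost s (sexpr b) + m1 + m2), s2; split=> //.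
  + by apply: run_while_true r1 r2; rewrite (sexpr_eval _ sa).
  + apply: leq_trans (leq_add (leq_add (expr_cost_le _ bs) l1) l2) _.
    by rewrite -!mulnDl leq_mul2r /=; nia.
  + exact: outside_trans o1 o2.
- move=> b c a eb s sa bs; exists (expr_cost s (sexpr b)), s; split=> //.
  + by apply: run_while_false; rewrite (sexpr_eval _ sa).
  + apply: leq_trans (expr_cost_le _ bs) _.
    by rewrite leq_mul2r /=; nia.
Qed.

End Simulation.

(** A step alters at most one entry. This prepares a lower bound on the multiplication time: [omega]
    is an arbitrary real, so [n ^ 2 = O(n ^ omega)], needed to absorb the loops over all cells, has
    to be extracted from the program itself. *)
Lemma arith_run_written cap c a t a' b : arith_run cap c a t a' ->
  exists2 l : seq nat, size l <= t & forall i, i \notin l -> entry a' b i = entry a b i.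
Proof.
elim=> {c a t a'}.
- by move=> a; exists [::].
- move=> [j|b' j e] a a' /=; first by case: ifP => // _ [<-]; exists [::].
  move=> [<-]; exists [:: eval (idx a) j] => //= i; rewrite inE => /negPf ij.
  by rewrite upd2E ij andbF.
- move=> c1 c2 a1 a2 a3 t1 t2 _ [l1 s1 h1] _ [l2 s2 h2].
  exists (l1 ++ l2) => [|i]; first by rewrite size_cat leq_add.
  by rewrite mem_cat negb_or => /andP[i1 i2]; rewrite h2 ?h1.
- by move=> _ c1 c2 a a' t _ _ [l sl h]; exists l => //; apply: leq_trans sl _.
- by move=> _ c1 c2 a a' t _ _ [l sl h]; exists l => //; apply: leq_trans sl _.
- move=> _ c a1 a2 a3 t1 t2 _ _ [l1 s1 h1] _ [l2 s2 h2].
  exists (l1 ++ l2) => [|i]; first by rewrite size_cat; lia.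
  by rewrite mem_cat negb_or => /andP[i1 i2]; rewrite h2 ?h1.
- by move=> _ c a _; exists [::].
Qed.

(** Every entry of the product of two all-ones matrices has to be written. *)
Lemma matmul_time_lower cap c n t a :
  arith_run cap c (matmul_input (const_mx 1%R : 'M[int]_n) (const_mx 1%R)) t a ->
  (forall i j : 'I_n, entry a 2 (i * n + j) =
     ((const_mx 1%R : 'M[int]_n) *m const_mx 1%R)%R i j) ->
  n * n <= t.
Proof.
move=> r prod; have [l sl h] := arith_run_written 2 r.
apply: leq_trans sl; rewrite -[n * n](size_iota 0) uniq_leq_size ?iota_uniq // => p.
rewrite mem_iota /= add0n => lt_p; apply/negPn/negP => /h.
have n_gt0 : 0 < n by case: (n) lt_p.
have lt_q : p %/ n < n by rewrite ltn_divLR.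
have := prod (Ordinal lt_q) (Ordinal (ltn_pmod p n_gt0)).
rewrite /= -divn_eq => ->; rewrite mxE.
under eq_bigr do rewrite !mxE mulr1.
by rewrite sumr_const card_ord => /eqP; rewrite pnatr_eq0 eqn0Ngt n_gt0.
Qed.

(** * Weights of walks and minimum cycle means *)

Lemma ex_min_nat (P : nat -> Prop) :
  (exists v, P v) -> exists v, P v /\ forall u, P u -> v <= u.
Proof.
move=> [v Pv]; have exP : exists v, `[< P v >] by exists v; apply/asboolP.
exists (ex_minn exP); case: ex_minnP => m /asboolP Pm le_m; split=> // u Pu.
by apply: le_m; apply/asboolP.
Qed.

Section Walks.

Variables (n : nat) (e : rel 'I_n) (w : 'I_n -> 'I_n -> nat).

Let W := max_weight e w.

Fixpoint wt (x : 'I_n) (p : seq 'I_n) : nat :=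
  if p is y :: p' then w x y + wt y p' else 0.

Definition closed_walk (y : 'I_n) (q : seq 'I_n) : Prop :=
  [/\ q != [::], path e y q & last y q = y].

Lemma wt_cat x p q : wt x (p ++ q) = wt x p + wt (last x p) q.
Proof. by elim: p x => //= y p IHp x; rewrite IHp addnA. Qed.

Lemma le_max_weight x y : e x y -> w x y <= W.
Proof.
by move=> exy; rewrite /W /max_weight (@leq_bigmax_cond _ _ _ (x, y)).
Qed.

Lemma wt_le x p : path e x p -> wt x p <= size p * W.
Proof.
elim: p x => //= y p IHp x /andP[exy py].
by rewrite mulSn leq_add ?le_max_weight ?IHp.
Qed.

Lemma cycle_weight_cons (x : 'I_n) q : cycle_weight w (x :: q) = wt x (rcons q x).
Proof.
(* The closing vertex is detached from the starting one, which the induction has to move. *)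
rewrite /cycle_weight rot1_cons; move: {2 4}x => z.
elim: q x => [|y q IHq] x /=; first by rewrite big_cons big_nil.
by rewrite big_cons IHq.
Qed.

Lemma last_take (x : 'I_n) p i : i <= size p -> last x (take i p) = nth x (x :: p) i.
Proof.
elim: p x i => [|y p IHp] x [|i] //= le_i.
by rewrite IHp // (set_nth_default x).
Qed.

(** Pigeonhole: two of the first [n + 1] vertices coincide, and the piece between them is [p2]. *)
Lemma walk_split x p : path e x p -> n <= size p ->
  exists p1 p2 p3,
    [/\ p = p1 ++ p2 ++ p3, closed_walk (last x p1) p2 & size p2 <= n].
Proof.
move=> px le_n; have sz : size (x :: take n p) = n.+1 by rewrite /= size_takel.
have /(uniqPn x) [i [j [lt_ij]]] : ~~ uniq (x :: take n p).
  by apply/negP => /card_uniqP; have := max_card [in x :: take n p];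
    rewrite card_ord sz => /[swap] ->; rewrite ltnn.
rewrite sz ltnS => le_j.
have nthE k : k <= n -> nth x (x :: take n p) k = last x (take k p).
  case: k => [|k] lt_k /=; first by rewrite take0.
  by rewrite nth_take // last_take ?(leq_trans lt_k).
rewrite !nthE //; last by lia.
move=> eq_last; exists (take i p), (take (j - i) (drop i p)), (drop j p).
have cat1 : take i p ++ take (j - i) (drop i p) = take j p.
  rewrite -[in RHS](@subnKC i j) ?(ltnW lt_ij) // takeD //.
have p_eq : p = take i p ++ take (j - i) (drop i p) ++ drop j p.
  by rewrite catA cat1 cat_take_drop.
have sz2 : size (take (j - i) (drop i p)) = j - i.
  by rewrite size_takel // size_drop; lia.
split=> //; last by rewrite sz2; lia.
split.
- by rewrite -size_eq0 sz2; lia.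
- by move: px; rewrite {1}p_eq !cat_path => /and3P[].
- by rewrite -last_cat cat1.
Qed.

(** The mean [w0 / l0] as a lower bound, cross-multiplied. The restriction to short closed walks,
    which makes a minimum easy to find, is lifted in [lower_mean_closed]. *)
Definition lower_mean (x : 'I_n) (w0 l0 : nat) : Prop :=
  forall (y : 'I_n) q, connect e x y -> closed_walk y q -> size q <= n ->
  w0 * size q <= wt y q * l0.

(** As long as a walk has at least [n] edges, it contains a short closed walk
    that can be cut out. *)
Lemma walk_lower (x : 'I_n) w0 l0 (z : 'I_n) p : lower_mean x w0 l0 -> connect e x z ->
  path e z p -> w0 * size p <= wt z p * l0 + n * w0.
Proof.
move=> low xz; move: {2}(size p).+1 (ltnSn (size p)) => m.
elim: m p => // m IHm p; rewrite ltnS => le_m zp.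
have [le_n|lt_n] := leqP n (size p); last by nia.
have [p1 [p2 [p3 [p_eq cw sz2]]]] := walk_split zp le_n.
have [p2n _ last2] := cw.
move: zp; rewrite p_eq !cat_path => /and3P[zp1 zp2 zp3].
have x1 : connect e x (last z p1).
  by apply: connect_trans xz _; apply/connectP; exists p1.
have := low _ _ x1 cw sz2.
have := IHm (p1 ++ p3); rewrite !size_cat !wt_cat cat_path zp1 last2.
rewrite last2 in zp3; rewrite zp3.
move: p2n le_m; rewrite p_eq !size_cat -size_eq0 => p2n le_m.
have lt_m : size p1 + size p3 < m.
  move: p2n le_m; rewrite -lt0n; move: (size p1) (size p2) (size p3) => a b c; lia.
move=> /(_ lt_m isT); lia.
Qed.

Lemma iter_walk (y : 'I_n) q m : closed_walk y q ->
  [/\ path e y (flatten (nseq m q)), last y (flatten (nseq m q)) = y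
    & wt y (flatten (nseq m q)) = m * wt y q].
Proof.
move=> [_ yq lq]; elim: m => //= m [IH1 IH2 IH3].
by rewrite cat_path last_cat wt_cat lq yq IH1 IH2 IH3 mulSn.
Qed.

Lemma size_flatten_nseq (q : seq 'I_n) m : size (flatten (nseq m q)) = m * size q.
Proof. by elim: m => //= m IHm; rewrite size_cat IHm mulSn. Qed.

(** Each repetition of a violating closed walk increases the deficit by at least 1, while the slack
    in [walk_lower] remains [n * w0]; hence [n * w0 + 1] repetitions contradict it. *)
Lemma lower_mean_closed (x : 'I_n) w0 l0 (z : 'I_n) q : lower_mean x w0 l0 -> connect e x z ->
  closed_walk z q -> w0 * size q <= wt z q * l0.
Proof.
move=> low xz cw; rewrite leqNgt; apply/negP => lt_q.
have [pN _ wN] := iter_walk (n * w0).+1 cw.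
have := walk_lower low xz pN; rewrite wN size_flatten_nseq.
by move: lt_q; nia.
Qed.

Lemma connect_short (x y : 'I_n) : connect e x y ->
  exists p, [/\ path e x p, last x p = y & size p <= n].
Proof.
move=> /connectP[p xp ->]; case: (shortenP xp) => p' xp' up' _.
exists p'; split=> //; have := card_uniqP up'.
by have := max_card [in x :: p']; rewrite card_ord => /[swap] -> /ltnW.
Qed.

(** Walk to the cycle, go round it as often as possible and finish with a partial round. The first
    and last pieces have at most [n] edges each, which accounts for [2 * n * W]. *)
Lemma walk_upper (x y : 'I_n) q T : connect e x y -> closed_walk y q -> size q <= n ->
  n <= T -> exists p, [/\ path e x p, size p = T
    & wt x p * size q <= wt y q * T + 2 * n * W * size q].
Proof.
move=> xy cw le_qn le_nT; have [p1 [xp1 lp1 sz1]] := connect_short xy.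
have [q0 yq lq] := cw; rewrite -size_eq0 in q0.
pose T' := T - size p1; pose m := T' %/ size q; pose r := T' %% size q.
have lt_r : r < size q by rewrite ltn_mod lt0n.
have [pm lm wm] := iter_walk m cw.
pose q' := take r q.
have yq' : path e y q' by move: yq; rewrite -{1}(cat_take_drop r q) cat_path => /andP[].
have szq' : size q' = r by rewrite size_takel // ltnW.
exists (p1 ++ flatten (nseq m q) ++ q'); split.
- by rewrite !cat_path xp1 lp1 pm lm.
- by rewrite !size_cat size_flatten_nseq szq' -divn_eq /T'; lia.
- rewrite !wt_cat lp1 lm wm.
  have := wt_le xp1; have := wt_le yq'; rewrite szq' => w2 w1.
  have w1' : wt x p1 <= n * W by apply: leq_trans w1 _; rewrite leq_mul2r sz1 orbT.
  have w2' : wt y q' <= n * W.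
    by apply: leq_trans w2 _; rewrite leq_mul2r orbC; apply/orP; left; lia.
  have mT : m * size q <= T by apply: leq_trans (leq_trunc_div _ _) (leq_subr _ _).
  have : m * size q * wt y q <= T * wt y q by rewrite leq_mul2r mT orbT.
  have : (wt x p1 + wt y q') * size q <= (2 * n * W) * size q.
    by rewrite leq_mul2r; apply/orP; right; lia.
  nia.
Qed.

Hypothesis out_edge : forall x : 'I_n, exists y, e x y.

Lemma walk_exists (x : 'I_n) T : exists2 p, path e x p & size p = T.
Proof.
elim: T x => [|T IHT] x; first by exists [::].
have [y exy] := out_edge x; have [p yp szp] := IHT y.
by exists (y :: p); rewrite /= ?exy ?szp.
Qed.

(** The length of a short closed walk divides the factorial of [n]. Scaling all means by this common
    denominator makes them naturals, among which a least one exists. *)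
Lemma best_cycle (x : 'I_n) : exists (y : 'I_n) q, [/\ connect e x y, closed_walk y q, size q <= n
  & lower_mean x (wt y q) (size q)].
Proof.
pose P v := exists (y : 'I_n) q, [/\ connect e x y, closed_walk y q, size q <= n
  & v = wt y q * (n`! %/ size q)].
have fact_div q : closed_walk q.1 q.2 -> size q.2 <= n ->
    n`! = n`! %/ size q.2 * size q.2.
  by move=> [q0 _ _] le_n; rewrite divnK // dvdn_fact // lt0n size_eq0 q0.
have [|v [[y [q [xy cw szq ->]]] min]] := @ex_min_nat P.
  have [p xp szp] := walk_exists x n.
  have [|p1 [p2 [p3 [p_eq cw sz2]]]] := walk_split xp; first by rewrite szp.
  exists (wt (last x p1) p2 * (n`! %/ size p2)), (last x p1), p2; split=> //.
  by apply/connectP; exists p1 => //; move: xp; rewrite p_eq cat_path => /andP[].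
exists y, q; split=> // y' q' xy' cw' szq'.
have : wt y q * (n`! %/ size q) <= wt y' q' * (n`! %/ size q').
  by apply: min; exists y', q'.
have := fact_div (y, q) cw szq; have := fact_div (y', q') cw' szq' => /=.
move: (n`! %/ size q') (n`! %/ size q) => a b ea eb le_ab.
rewrite -(@leq_pmul2r n`!) ?fact_gt0 //.
rewrite {1}eb ea.
have -> : wt y q * size q' * (b * size q) = (wt y q * b) * (size q' * size q) by ring.
have -> : wt y' q' * size q * (a * size q') = (wt y' q' * a) * (size q' * size q) by ring.
by rewrite leq_mul2r le_ab orbT.
Qed.

Lemma min_cycle_mean_best (R : realType) (x y : 'I_n) q : connect e x y ->
  closed_walk y q -> lower_mean x (wt y q) (size q) ->
  min_cycle_mean e w x ((wt y q)%:R / (size q)%:R : R)%R.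
Proof.
move=> xy cw low; split.
(* A closed walk ends in its base point, whereas a [cycle] list has it only at its head; so the last
   vertex is moved to the front. *)
- have [q0 yq lq] := cw; case/lastP: q q0 cw low yq lq => // q z _ cw low yq.
  rewrite last_rcons => zy; subst z; exists (y :: q); last first.
    by rewrite /cycle_mean cycle_weight_cons size_rcons.
  by split=> //=; rewrite xy.
- move=> c [c0 cyc hasc]; case: c c0 cyc hasc => // z c _ cyc hasc.
  have xz : connect e x z.
    have [u u_in xu] := hasP hasc; apply: connect_trans xu _.
    by apply: connect_cycle cyc _ _ u_in _; rewrite mem_head.
  have cwz : closed_walk z (rcons c z).
    by split; rewrite ?last_rcons // -size_eq0 size_rcons.
  have := lower_mean_closed low xz cwz; rewrite /cycle_mean cycle_weight_cons.
  rewrite size_rcons /= => le_w.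
  have q_gt0 : 0 < size q by have [q0 _ _] := cw; rewrite lt0n size_eq0.
  rewrite ler_pdivrMr ?ltr0n // mulrAC ler_pdivlMr ?ltr0n //.
  by rewrite -!natrM ler_nat.
Qed.

End Walks.

(** * Approximate min-plus squaring *)

Section MinPlus.

Variables (n : nat) (e : rel 'I_n) (w : 'I_n -> 'I_n -> nat) (r : nat).

(** In distance arrays, [0] stands for infinity and [v.+1] for [v].  The values
    of level [i] are lower bounds for the weights of walks with [2 ^ i] edges,
    tight up to a factor [1 - 4 * i / r]. *)
Definition level (i : nat) (D : nat -> nat) : Prop :=
  forall x y : 'I_n,
  (forall p, path e x p -> size p = 2 ^ i -> last x p = y ->
     0 < D (x * n + y) /\ (D (x * n + y)).-1 <= wt w x p) /\
  (forall v, D (x * n + y) = v.+1 -> exists p,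
     [/\ path e x p, size p = 2 ^ i, last x p = y
       & wt w x p * (r - 4 * i) <= r * v]).

Definition minplus_square (D D' : nat -> nat) : Prop :=
  forall x y : 'I_n,
  (forall (k : 'I_n) a b, D (x * n + k) = a.+1 -> D (k * n + y) = b.+1 ->
     0 < D' (x * n + y) /\ (D' (x * n + y)).-1 <= a + b) /\
  (forall v, D' (x * n + y) = v.+1 -> exists (k : 'I_n) a b,
     [/\ D (x * n + k) = a.+1, D (k * n + y) = b.+1
       & (a + b) * r <= v * (r + 4)]).

Lemma level0 D :
  (forall x y : 'I_n, D (x * n + y) = if e x y then (w x y).+1 else 0) -> level 0 D.
Proof.
move=> DE x y; rewrite DE; split=> [[|z [|? ?]] //= /andP[xz _] _ zy|v].
- by rewrite -zy xz addn0.
- case: ifP => // exy [<-]; exists [:: y]; split=> //=; first by rewrite exy.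
  by rewrite addn0 muln0 subn0 mulnC.
Qed.

(** The walk witnessing a finite entry is itself one of the walks that the entry must not exceed. *)
Lemma level_bound i D (x y : 'I_n) : level i D ->
  D (x * n + y) <= (2 ^ i * max_weight e w).+1.
Proof.
move=> lev; have [up low] := lev x y; case Dxy : (D _) => [//|v].
have [p [xp szp lp _]] := low v Dxy; have [_] := up p xp szp lp.
by rewrite Dxy /= ltnS => le_v; apply: leq_trans le_v _; rewrite -szp wt_le.
Qed.

(** The relative losses of [4 / r] add up: with [A = r - 4 * i <= r] one has
    [(A - 4) * (r + 4) <= A * r]. *)
Lemma level_step i D D' : 4 * i.+1 <= r -> level i D -> minplus_square D D' ->
  level i.+1 D'.
Proof.
move=> le_i lev sq x y; have [sq1 sq2] := sq x y; split.
- move=> p xp szp lp; rewrite expnS mul2n -addnn in szp.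
  move: (xp) (lp); rewrite -(cat_take_drop (2 ^ i) p) cat_path last_cat.
  set z := last x _ => /andP[xp1 zp2] lp2.
  have sz1 : size (take (2 ^ i) p) = 2 ^ i by rewrite size_takel // szp leq_addr.
  have sz2 : size (drop (2 ^ i) p) = 2 ^ i by rewrite size_drop szp addnK.
  have [/(_ _ xp1 sz1 erefl) [D1 le1] _] := lev x z.
  have [/(_ _ zp2 sz2 lp2) [D2 le2] _] := lev z y.
  have [||D'1 le'] := sq1 z (D (x * n + z)).-1 (D (z * n + y)).-1.
  + by rewrite prednK.
  + by rewrite prednK.
  by split=> //; rewrite wt_cat (leq_trans le') ?leq_add.
- move=> v /sq2 [k [a [b [Da Db le_ab]]]].
  have [_ /(_ _ Da) [p [xp szp lp le_p]]] := lev x k.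
  have [_ /(_ _ Db) [q [kq szq lq le_q]]] := lev k y.
  exists (p ++ q); split.
  + by rewrite cat_path xp lp.
  + by rewrite size_cat szp szq addnn -mul2n expnS.
  + by rewrite last_cat lp.
  rewrite wt_cat lp; set u := wt w x p + wt w k q.
  have {le_p le_q} le_u : u * (r - 4 * i) <= v * (r + 4) by rewrite /u; lia.
  have -> : r - 4 * i.+1 = (r - 4 * i) - 4 by lia.
  have : 4 <= r - 4 * i <= r by lia.
  move: (r - 4 * i) le_u => A le_u /andP[A4 Ar].
  rewrite -(@leq_pmul2r A); last by lia.
  have : u * A * (A - 4) <= v * (r + 4) * (A - 4) by rewrite leq_mul2r le_u orbT.
  have [c ec] : exists c, A = c + 4 by exists (A - 4); lia.
  have : v * c <= v * r by rewrite leq_mul2l; lia.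
  rewrite ec addnK; lia.
Qed.

(** The base exceeds the number [n] of summands in an entry of a product, so even [n] equal summands
    do not reach the next power. *)
Let X := n.+1.

(** Small distances receive large powers, so that the minimum dominates the sum. Infinity and
    entries out of range contribute nothing. *)
Definition enc (s d : nat) : nat :=
  if d is a.+1 then if a %/ s <= r then X ^ (r - a %/ s) else 0 else 0.

Definition encprod (D : nat -> nat) (s : nat) (x y : 'I_n) : nat :=
  \sum_(k < n) enc s (D (x * n + k)) * enc s (D (k * n + y)).

Lemma enc_le s d : enc s d <= X ^ r.
Proof.
by case: d => //= a; case: ifP => // _; rewrite leq_pexp2l ?leq_subr.
Qed.

Variable (D : nat -> nat).

Lemma encprod_lt s x y : encprod D s x y < X ^ r * X ^ r * X.
Proof.
apply: (@leq_ltn_trans (\sum_(k < n) X ^ r * X ^ r)).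
  by apply: leq_sum => k _; rewrite leq_mul ?enc_le.
by rewrite sum_nat_const card_ord mulnC ltn_pmul2l // muln_gt0 expn_gt0.
Qed.

Lemma encprod_accept s (x y k : 'I_n) a b :
  D (x * n + k) = a.+1 -> D (k * n + y) = b.+1 -> a %/ s + b %/ s <= r ->
  X ^ r <= encprod D s x y.
Proof.
move=> Da Db le_ab; rewrite /encprod (bigD1 k) //= Da Db /=.
apply: leq_trans (leq_addr _ _).
rewrite (leq_trans (leq_addr _ _) le_ab) (leq_trans (leq_addl _ _) le_ab).
move: le_ab; move: (a %/ s) (b %/ s) => a' b' le_ab.
by rewrite -expnD leq_pexp2l //; lia.
Qed.

(** Let [v] be the least rounded sum. Every term is at most [X ^ (2 r - v)], so the whole sum is
    below the next power; being accepted, it forces [v <= r]. Then both parts of an optimal pair are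
    in range, and its term attains [X ^ (2 r - v)]. *)
Lemma encprod_decode s x y : X ^ r <= encprod D s x y ->
  exists v, [/\ v <= r,
    X ^ (r - v) * X ^ r <= encprod D s x y < X ^ (r - v).+1 * X ^ r,
    forall (k : 'I_n) a b, D (x * n + k) = a.+1 -> D (k * n + y) = b.+1 ->
      v <= a %/ s + b %/ s
    & exists (k : 'I_n) a b, [/\ D (x * n + k) = a.+1, D (k * n + y) = b.+1
      & a %/ s + b %/ s = v]].
Proof.
move=> acc.
pose P v := exists (k : 'I_n) a b, [/\ D (x * n + k) = a.+1,
  D (k * n + y) = b.+1 & a %/ s + b %/ s = v].
have n_gt0 : 0 < n by exact: leq_ltn_trans (leq0n x) (ltn_ord x).
have X_gt1 : 1 < X by rewrite ltnS.
have encP d : 0 < enc s d -> exists2 a, d = a.+1 & enc s d = X ^ (r - a %/ s) /\ a %/ s <= r.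
  by case: d => //= a; case: ifP => // le_a _; exists a.
have [u Pu le_u] : exists2 u, P u & u <= r + r.
  have [k k_gt0] : exists k : 'I_n, 0 < enc s (D (x * n + k)) * enc s (D (k * n + y)).
    have Xr0 : 0 < X ^ r by rewrite expn_gt0.
    have := leq_trans Xr0 acc; rewrite lt0n sum_nat_eq0 => /forallPn[k].
    by rewrite -lt0n; exists k.
  move: k_gt0; rewrite muln_gt0 => /andP[/encP [a Da [_ la]] /encP [b Db [_ lb]]].
  by exists (a %/ s + b %/ s); [exists k, a, b | rewrite leq_add].
have [v [Pv minv]] := @ex_min_nat P (ex_intro _ u Pu).
have le_vu := minv u Pu.
have le_term (k : 'I_n) : enc s (D (x * n + k)) * enc s (D (k * n + y)) <= X ^ (r + r - v).
  have [->|] := posnP (enc s (D (x * n + k))); first by rewrite mul0n.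
  have [->|] := posnP (enc s (D (k * n + y))); first by rewrite muln0.
  move=> /encP [b Db [-> le_b]] /encP [a Da [-> le_a]].
  have : v <= a %/ s + b %/ s by apply: minv; exists k, a, b.
  move: (a %/ s) (b %/ s) le_a le_b => a' b' le_a le_b le_v.
  by rewrite -expnD leq_pexp2l //; lia.
have lt_sum : encprod D s x y < X ^ (r + r - v).+1.
  apply: (@leq_ltn_trans (\sum_(k < n) X ^ (r + r - v))); first exact: leq_sum.
  by rewrite sum_nat_const card_ord expnS ltn_pmul2r ?expn_gt0.
have le_v : v <= r.
  by have := leq_ltn_trans acc lt_sum; rewrite ltn_exp2l //; lia.
exists v; split=> //; last by move=> k a b Da Db; apply: minv; exists k, a, b.
have vE : r - v + r = r + r - v by lia.
rewrite -!expnD addSn vE lt_sum andbT.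
have [k [a [b [Da Db ab]]]] := Pv.
have le_ab : a %/ s + b %/ s <= r by rewrite ab.
rewrite /encprod (bigD1 k) //= Da Db /=.
rewrite (leq_trans (leq_addr _ _) le_ab) (leq_trans (leq_addl _ _) le_ab).
move: ab le_ab; move: (a %/ s) (b %/ s) => a' b' ab le_ab.
have -> : r + r - v = r - a' + (r - b') by lia.
by rewrite -expnD leq_addr.
Qed.

(** [t] scales are tried; the finest accepted one determines the result. *)
Definition scaled_square (t : nat) (D' : nat -> nat) : Prop :=
  forall x y : 'I_n,
  (D' (x * n + y) = 0 /\ forall i, i < t -> encprod D (2 ^ i) x y < X ^ r) \/
  (exists i v, [/\ i < t, D' (x * n + y) = (2 ^ i * v).+1, v <= r,
     forall j, j < i -> encprod D (2 ^ j) x y < X ^ r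
   & X ^ (r - v) * X ^ r <= encprod D (2 ^ i) x y < X ^ (r - v).+1 * X ^ r]).

(** Rejection at the next finer scale means that [v] is at least [r / 2] at the accepted one.
    Rounding loses less than two units there, that is, less than the fraction [4 / r] of [v]
    units. *)
Lemma scaled_squareP t D' : ~~ odd r ->
  (forall x y : 'I_n, D (x * n + y) <= 2 ^ t) ->
  scaled_square t.+1 D' -> minplus_square D D'.
Proof.
move=> r_even leD sq x y.
have n_gt0 : 0 < n by exact: leq_ltn_trans (leq0n x) (ltn_ord x).
have X_gt1 : 1 < X by rewrite ltnS.
have [[D0 rej]|[i [v [lt_it D'E le_v rej dec]]]] := sq x y.
  (* At the coarsest scale every finite entry is rounded to 0, so rejection there excludes any
     pair. *)
  rewrite D0; split=> // k a b Da Db; have := rej t (ltnSn t).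
  rewrite ltnNge (encprod_accept Da Db) //.
  have := leD x k; have := leD k y; rewrite Da Db => lb la.
  by rewrite !divn_small.
have acc : X ^ r <= encprod D (2 ^ i) x y.
  by have /andP[+ _] := dec; apply: leq_trans; rewrite leq_pmull ?expn_gt0.
have [v' [le_v' dec' min [k [a [b [Da Db ab]]]]]] := encprod_decode acc.
have {dec dec'} ev : v' = v.
  have Xr0 : 0 < X ^ r by rewrite expn_gt0.
  have /andP[l1 u1] := dec; have /andP[l2 u2] := dec'.
  have := leq_ltn_trans l1 u2; have := leq_ltn_trans l2 u1.
  by rewrite !ltn_pmul2r // !ltn_exp2l // !ltnS; clear -le_v le_v'; lia.
rewrite ev in min ab.
have p_gt0 : 0 < 2 ^ i by rewrite expn_gt0.
split.
- move=> k' a' b' Da' Db'; rewrite D'E; split=> //=.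
  have le_min := min _ _ _ Da' Db'.
  have := leq_trunc_div a' (2 ^ i); have := leq_trunc_div b' (2 ^ i).
  have : 2 ^ i * v <= 2 ^ i * (a' %/ 2 ^ i + b' %/ 2 ^ i) by rewrite leq_mul2l le_min orbT.
  rewrite mulnDr ![2 ^ i * (_ %/ _)]mulnC; move: (2 ^ i * v) (a' %/ _ * _) (b' %/ _ * _).
  by clear; lia.
- move=> u; rewrite D'E => -[<-]; exists k, a, b; split=> //.
  have lta := ltn_ceil a p_gt0; have ltb := ltn_ceil b p_gt0.
  (* Scale [2 ^ 0] rounds nothing and is exact. *)
  case: i => [|i] in lt_it D'E rej acc min ab p_gt0 lta ltb *.
    rewrite expn0 !divn1 in ab; rewrite expn0 mul1n -ab; nia.
  have := rej i (ltnSn i); rewrite ltnNge => /negP nacc.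
  have gt_r : r < a %/ 2 ^ i + b %/ 2 ^ i.
    by rewrite ltnNge; apply/negP => le_ab; apply: nacc; apply: encprod_accept Da Db le_ab.
  have half c : c %/ 2 ^ i <= (c %/ 2 ^ i.+1).*2.+1.
    by rewrite expnSr divnMA; clear; lia.
  have := half a; have := half b => hb ha.
  (* The halves give [r < 2 * v + 2]; evenness of [r] gains the missing unit. *)
  have le_rv : r <= 2 * v by lia.
  have ab_lt : a + b <= 2 ^ i.+1 * (v + 2) by rewrite -ab; clear -lta ltb; nia.
  apply: leq_trans (_ : 2 ^ i.+1 * (v + 2) * r <= _).
    by rewrite leq_mul2r ab_lt orbT.
  rewrite -!mulnA leq_mul2l; apply/orP; right.
  by clear -le_rv; nia.
Qed.

End MinPlus.

(** * The program *)

Notation "c1 ;; c2" := (Seq c1 c2) (at level 90, right associativity).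
Notation "x <~ e" := (Instr (Assign x e) : ram_prog) (at level 80).
Notation put a j e := (Instr (Write a j e) : ram_prog).
Notation "e1 +' e2" := (Op Add e1 e2) (at level 50, left associativity).
Notation "e1 -' e2" := (Op Defs.Sub e1 e2) (at level 50, left associativity).
Notation "e1 *' e2" := (Op Mul e1 e2) (at level 40, left associativity).
Notation "e1 /' e2" := (Op Div e1 e2) (at level 40, left associativity).

Notation v_n := 0 (only parsing).
Notation v_nn := 1 (only parsing).
Notation v_W := 2 (only parsing).
Notation v_E := 3 (only parsing).
Notation v_K := 4 (only parsing).
Notation v_T := 5 (only parsing).
Notation v_r := 6 (only parsing).
Notation v_rho := 7 (only parsing).
Notation v_Xr := 8 (only parsing).
Notation v_M := 9 (only parsing).
Notation v_G := 10 (only parsing).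
Notation v_g := 11 (only parsing).
Notation v_s := 12 (only parsing).
Notation v_p := 13 (only parsing).
Notation v_i := 14 (only parsing).
Notation v_a := 15 (only parsing).
Notation v_e := 16 (only parsing).
Notation v_u := 17 (only parsing).
Notation v_v := 18 (only parsing).
Notation v_j := 19 (only parsing).
Notation v_q := 20 (only parsing).
Notation v_d := 21 (only parsing).
Notation v_h := 22 (only parsing).
Notation v_x := 23 (only parsing).
Notation v_k := 24 (only parsing).
Notation v_b := 25 (only parsing).
Notation a_num := 3 (only parsing).
Notation a_den := 4 (only parsing).
Notation a_D := 5 (only parsing).
Notation a_Z := 6 (only parsing).
Notation a_V := 7 (only parsing).
Notation a_S := 8 (only parsing).
Notation a_pow := 9 (only parsing).

Definition scan_cell : ram_prog :=
  If (Read 1 (Var v_p) -' Var v_W) (v_W <~ Read 1 (Var v_p)) Skip.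

Definition scan : ram_prog :=
  v_nn <~ Var v_n *' Var v_n;; For v_p v_nn scan_cell.

Definition zero_output : ram_prog := For v_x v_n (put a_den (Var v_x) (Const 1)).

Definition setup_E : ram_prog :=
  v_E <~ Const 1;;
  While (Const 1 -' Read 2 (Var v_k))
    (v_k <~ Var v_k +' Const 1;; v_E <~ Var v_E *' Const 2).

Definition setup_T : ram_prog :=
  v_b <~ Const 16 *' (Var v_n *' Var v_n) *' Var v_W *' Var v_E;;
  v_T <~ Const 1;;
  While (Var v_b -' Var v_T)
    (v_T <~ Var v_T *' Const 2;; v_K <~ Var v_K +' Const 1).

Definition setup_r : ram_prog :=
  v_b <~ Const 16 *' Var v_K *' Var v_E;;
  v_r <~ Const 1;;
  While (Var v_b -' Var v_r)
    (v_r <~ Var v_r *' Const 2;; v_rho <~ Var v_rho +' Const 1).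

Definition square_pow : ram_prog :=
  put a_pow (Var v_j +' Const 1) (Read a_pow (Var v_j) *' Read a_pow (Var v_j)).

(** As [r = 2 ^ rho], the last square is [X ^ r]; the others are the weights of the binary digits in
    [decode_digit]. *)
Definition setup_pow : ram_prog :=
  put a_pow (Const 0) (Var v_n +' Const 1);; For v_j v_rho square_pow.

(** [M] is the strict bound of [encprod_lt], so reduction modulo [M] loses nothing of the result.
    The calls are numbered from 1 to [2 * K * K], hence all below [G]. An exponent up to [r] needs
    [rho + 1] digits. *)
Definition setup_mod : ram_prog :=
  v_Xr <~ Read a_pow (Var v_rho);;
  v_M <~ Var v_Xr *' Var v_Xr *' (Var v_n +' Const 1);;
  v_G <~ Const 2 *' Var v_K *' Var v_K +' Const 1;;
  v_b <~ Var v_rho +' Const 1.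

Definition init_cell : ram_prog :=
  put a_D (Var v_p) (Read 0 (Var v_p) *' (Read 1 (Var v_p) +' Const 1)).

Definition init_D : ram_prog := For v_p v_nn init_cell.

(** Array [a_Z] holds the powers of [n + 1] whose exponents are the distances in
    units of the current scale, and is updated by squaring when the scale is
    halved.  Arrays [12] and [14] are the operands of the matrix multiplication
    program and array [16] is its result. *)
Definition encode_cell : ram_prog :=
  v_e <~ Const 0;;
  If (Read a_D (Var v_p)) (
    v_a <~ (Read a_D (Var v_p) -' Const 1) /' Var v_s;;
    If (Var v_r +' Const 1 -' Var v_a) (
      put a_Z (Var v_p) (Read a_Z (Var v_p) *' Read a_Z (Var v_p) *'
        (Const 1 +' (Var v_a -' Var v_a /' Const 2 *' Const 2) *' Var v_n));;
      v_e <~ Var v_Xr /' Read a_Z (Var v_p)) Skip) Skip;;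
  put 12 (addr (Var v_p)) (Var v_e);;
  put 14 (addr (Var v_p)) (Var v_e).

Definition encode : ram_prog := For v_p v_nn encode_cell.

(** Scales are visited from coarse to fine, so overwriting leaves the finest accepted one. *)
Definition collect_cell : ram_prog :=
  v_u <~ Read 16 (addr (Var v_p));;
  If (Var v_u +' Const 1 -' Var v_Xr)
    (put a_V (Var v_p) (Var v_u);; put a_S (Var v_p) (Var v_s)) Skip.

Definition collect : ram_prog := For v_p v_nn collect_cell.

(** Cell [g] of array 10 is the simulated variable 0, in which the multiplication program expects
    the dimension. *)
Definition scale (P : arith_prog) : ram_prog :=
  (v_s <~ Var v_s /' Const 2;; v_g <~ Var v_g +' Const 1);;
  encode;;
  put 10 (Var v_g) (Var v_n);;
  scmd P;;
  collect.

(** The exponent of [n + 1] in [V[p] / X^r] is found digit by digit. *)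
Definition decode_digit : ram_prog :=
  v_q <~ Var v_q /' Const 2;;
  If (Var v_u +' Const 1 -' Read a_pow (Var v_rho -' Var v_j)) (
    v_u <~ Var v_u /' Read a_pow (Var v_rho -' Var v_j);;
    v_v <~ Var v_v -' Var v_q) Skip.

Definition decode_cell : ram_prog :=
  (v_u <~ Read a_V (Var v_p) /' Var v_Xr;;
   v_v <~ Var v_r;;
   v_q <~ Const 2 *' Var v_r);;
  For v_j v_b decode_digit;;
  put a_D (Var v_p) (Read a_S (Var v_p) *' Var v_v +' Const 1).

Definition decode : ram_prog :=
  For v_p v_nn
    (If (Read a_V (Var v_p)) decode_cell (put a_D (Var v_p) (Const 0))).

(** The scale starts at [T * T], above all distances: all quotients are 0 and the matching power of
    [X] is 1. The value 0 in [a_V] records that no scale was accepted. *)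
Definition reset_cell : ram_prog :=
  put a_V (Var v_p) (Const 0);; put a_Z (Var v_p) (Const 1).

Definition square (P : arith_prog) : ram_prog :=
  For v_p v_nn reset_cell;;
  v_s <~ Var v_T *' Var v_T;;
  While (Var v_s -' Const 1) (scale P);;
  decode.

(** With 0 standing for infinity, the test holds exactly if [h] is finite and [d] is infinite or
    larger than [h]. *)
Definition min_cell : ram_prog :=
  v_h <~ Read a_D (Var v_x *' Var v_n +' Var v_j);;
  If (Var v_h *' ((Const 1 -' Var v_d) +' (Var v_d -' Var v_h)))
    (v_d <~ Var v_h) Skip.

(** [v_d] is one more than the distance, whence the [+ 1] in the threshold [2 * n * W] that
    separates mean 0 from positive means. *)
Definition write_cell : ram_prog :=
  put a_den (Var v_x)
    ((Var v_r -' Const 4 *' Var v_K) *' (Var v_T -' Var v_n));;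
  If (Var v_d -' (Const 2 *' Var v_n *' Var v_W +' Const 1))
    (put a_num (Var v_x) ((Var v_d -' Const 1) *' Var v_r))
    (put a_num (Var v_x) (Const 0)).

Definition write_output : ram_prog :=
  For v_x v_n (v_d <~ Const 0;; For v_j v_n min_cell;; write_cell).

Definition positive_case (P : arith_prog) : ram_prog :=
  setup_E;; setup_T;; setup_r;; setup_pow;; setup_mod;; init_D;;
  For v_i v_K (square P);; write_output.

Definition approx_mcm (P : arith_prog) : ram_prog :=
  scan;; If (Var v_W) (positive_case P) zero_output.

(** The simulation writes only to arrays, so the loop counters and parameters of the caller survive
    a call. *)
Lemma modv_scmd c : modv (scmd c) = [::].
Proof. by elim: c => //= [[[]|]|c1 -> c2 ->|b c1 -> c2 ->]. Qed.

Lemma flat_ord (T : Type) n (z : T) (f : 'I_n -> 'I_n -> T) (i j : 'I_n) :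
  flat z f (i * n + j) = f i j.
Proof.
have n_gt0 : 0 < n by exact: leq_ltn_trans (leq0n i) (ltn_ord i).
rewrite /flat divnMDl // (divn_small (ltn_ord j)) addn0 modnMDl.
by rewrite (modn_small (ltn_ord j)) !valK.
Qed.

Lemma flat_out (T : Type) n (z : T) (f : 'I_n -> 'I_n -> T) p :
  n * n <= p -> flat z f p = z.
Proof.
by case: n f => [|n] f le_p; rewrite /flat insubN // -leqNgt leq_divRL.
Qed.

Lemma flat_cell n p : p < n * n -> exists i j : 'I_n, p = i * n + j.
Proof.
move=> lt_p; have n_gt0 : 0 < n by case: (n) lt_p.
have lt_q : p %/ n < n by rewrite ltn_divLR.
by exists (Ordinal lt_q), (Ordinal (ltn_pmod p n_gt0)); rewrite /= -divn_eq.
Qed.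

Lemma lt_cell n (i j : 'I_n) : i * n + j < n * n.
Proof.
by rewrite -ltn_divLR ?divnMDl ?(divn_small (ltn_ord j)) ?addn0 //;
  exact: leq_ltn_trans (leq0n i) (ltn_ord i).
Qed.

Arguments upd T f x v y /.
Arguments upd2 T f a i v / _ _.
Arguments setv s x v /.

(** * Correctness of the program *)

Section Correctness.

Variables (n : nat) (e : rel 'I_n) (w : 'I_n -> 'I_n -> nat).
Variables (P : arith_prog) (k B cap tau : nat).

Variables (W E K T rho r X Xr M G : nat).
Hypotheses (W_def : W = max_weight e w) (E_def : E = 2 ^ k).
Hypotheses (K_def : K = up_log 2 (16 * (n * n) * W * E)) (T_def : T = 2 ^ K).
Hypotheses (rho_def : rho = up_log 2 (16 * K * E)) (r_def : r = 2 ^ rho).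
Hypotheses (X_def : X = n.+1) (Xr_def : Xr = X ^ r).
Hypotheses (M_def : M = Xr * Xr * X) (G_def : G = 2 * K * K + 1).

Hypotheses (n_gt0 : 0 < n) (W_gt0 : 0 < W) (le_MB : M <= B) (le_capB : cap <= B).
Hypothesis matmulP : forall A A' : 'M[int]_n, exists t a,
  [/\ arith_run cap P (matmul_input A A') t a,
      forall i j : 'I_n, entry a 2 (i * n + j) = (A *m A')%R i j & t <= tau].

(** * Inequalities between the parameters *)

Lemma leT : 16 * (n * n) * W * E <= T.
Proof. by rewrite T_def K_def up_logP. Qed.

Lemma E_gt0 : 0 < E. Proof. by rewrite E_def expn_gt0. Qed.

Lemma T_gt0 : 0 < T. Proof. by rewrite T_def expn_gt0. Qed.

Lemma X_gt1 : 1 < X. Proof. by rewrite X_def. Qed.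

Lemma T_ge : [/\ 16 * W <= T, 16 * E <= T, 16 * (n * n) <= T & 16 * n <= T].
Proof.
have leT := leT; have E0 := E_gt0.
have nn0 : 0 < n * n by rewrite muln_gt0 n_gt0.
have WE0 : 0 < W * E by rewrite muln_gt0 W_gt0.
have nW0 : 0 < n * n * W by rewrite muln_gt0 nn0.
have nE0 : 0 < n * n * E by rewrite muln_gt0 nn0.
have h16 : 16 * (n * n) <= T by apply: leq_trans leT; rewrite -mulnA leq_pmulr.
split=> //.
- apply: leq_trans leT; have -> : 16 * (n * n) * W * E = 16 * W * (n * n * E) by lia.
  by rewrite leq_pmulr.
- apply: leq_trans leT; have -> : 16 * (n * n) * W * E = 16 * E * (n * n * W) by lia.
  by rewrite leq_pmulr.
- by apply: leq_trans h16; rewrite leq_mul2l /= leq_pmulr.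
Qed.

Lemma K_ge : 4 <= K.
Proof.
have [_ _ _ h] := T_ge; rewrite -(leq_exp2l _ _ (ltnSn 1)) -T_def.
by apply: leq_trans h; rewrite leq_pmulr.
Qed.

Lemma le_r : 16 * K * E <= r. Proof. by rewrite r_def rho_def up_logP. Qed.

Lemma r_ge : [/\ 16 * K <= r, 64 <= r & 16 * E <= r].
Proof.
have le_r := le_r; have E0 := E_gt0; have K4 := K_ge.
have h : 16 * K <= r by apply: leq_trans le_r; rewrite leq_pmulr.
split=> //; first by lia.
by apply: leq_trans le_r; rewrite leq_mul2r; apply/orP; right; lia.
Qed.

Lemma rho_gt0 : 0 < rho.
Proof. by have [_ + _] := r_ge; rewrite r_def; case: (rho). Qed.

(** [T ^ 3 * r] bounds the numbers that are stored, except for encoded distances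
    and the memory of the matrix multiplication program. *)
Lemma le_T3r : T * T * T * r <= Xr.
Proof.
have [rK r64 _] := r_ge; have K4 := K_ge.
(* One half of the exponent [r] pays for [2 * T ^ 3], the other for the factor [h]. *)
have [h rh] : exists h, r = h + h.
  by exists (2 ^ rho.-1); rewrite r_def addnn -mul2n -expnS prednK ?rho_gt0.
have hK : 8 * K <= h by lia.
have : T * T * T * r <= 2 ^ h * 2 ^ h.
  have lt_h : h < 2 ^ h by rewrite ltn_expl.
  have le_T : T * T * T * 2 <= 2 ^ h.
    by rewrite T_def -!expnD -expnSr leq_exp2l //; lia.
  have := leq_mul le_T (ltnW lt_h).
  by rewrite rh; clear; lia.
move/leq_trans; apply; rewrite -expnD -rh Xr_def leq_exp2r ?X_gt1 //; lia.
Qed.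

Lemma Xr_gt0 : 0 < Xr. Proof. by rewrite Xr_def expn_gt0 X_def. Qed.

Lemma Xr_le : Xr <= B.
Proof.
apply: leq_trans le_MB.
by rewrite M_def -mulnA leq_pmulr // muln_gt0 Xr_gt0 X_def.
Qed.

Lemma T_ge16 : 16 <= T.
Proof. by have [_ _ _] := T_ge; apply: leq_trans; rewrite leq_pmulr. Qed.

Lemma T3r_le : T * T * T * r <= B.
Proof. exact: leq_trans le_T3r Xr_le. Qed.

Lemma T3_le : T * T * T <= B.
Proof.
apply: leq_trans T3r_le; rewrite leq_pmulr //.
by have [_ h _] := r_ge; apply: leq_trans h.
Qed.

Lemma T_le : T <= B.
Proof.
by apply: leq_trans T3_le; rewrite leq_pmull // muln_gt0 T_gt0.
Qed.

Lemma r_le : r <= B.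
Proof.
by apply: leq_trans T3r_le; rewrite leq_pmull // !muln_gt0 T_gt0.
Qed.


(** * One scale: encoding, multiplication, collection *)

Record par (s : store) : Prop := Par {
  par_n : var s v_n = n; par_nn : var s v_nn = n * n; par_W : var s v_W = W;
  par_K : var s v_K = K; par_T : var s v_T = T; par_r : var s v_r = r;
  par_rho : var s v_rho = rho; par_Xr : var s v_Xr = Xr; par_M : var s v_M = M;
  par_G : var s v_G = G; par_b : var s v_b = rho.+1;
  par_pow : forall j, j <= rho -> arr s a_pow j = X ^ (2 ^ j) }.

Lemma par_agree c s s' :
  all [predC [:: v_n; v_nn; v_W; v_K; v_T; v_r; v_rho; v_Xr; v_M; v_G; v_b]] (modv c) ->
  a_pow \notin moda c -> agree c s s' -> par s -> par s'.
Proof.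
move=> /allP mc ac [v a] [? ? ? ? ? ? ? ? ? ? ? ?].
split; first [by move=> j le_j; rewrite a ?ac; auto
  | by rewrite v //; apply/negP => /mc].
Qed.

(** Demanded only in range: a finer scale never decreases the quotient, so an entry that has left
    the range will not need its power again. *)
Definition powers (sc : nat) (D Z : nat -> nat) (p : nat) : Prop :=
  forall a, D p = a.+1 -> a %/ sc <= r -> Z p = X ^ (a %/ sc).

Definition encoded g sc (s : store) b p :=
  arr s b (p * G + g) = enc n r sc (arr s a_D p).

Lemma tri_encode s sc g : par s -> var s v_s = sc -> var s v_g = g -> g < G ->
  (forall p, p < n * n -> powers (sc * 2) (arr s a_D) (arr s a_Z) p) ->
  tri B encode s (n * n * (csize encode_cell + 40) + 40) (fun s' =>
    [/\ forall p, p < n * n -> powers sc (arr s' a_D) (arr s' a_Z) p,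
        forall p, p < n * n -> encoded g sc s' 12 p /\ encoded g sc s' 14 p
      & forall b (q : nat), b = 12 \/ b = 14 -> (forall p, p < n * n -> q != p * G + g) ->
          arr s' b q = arr s b q]).
Proof.
move=> ps sE gE lt_gG pow0.
pose I i s' := [/\ forall p, p < n * n -> powers (if p < i then sc else sc * 2)
                     (arr s' a_D) (arr s' a_Z) p,
        forall p, p < i -> encoded g sc s' 12 p /\ encoded g sc s' 14 p
      & forall b (q : nat), b = 12 \/ b = 14 -> (forall p, p < i -> q != p * G + g) ->
          arr s' b q = arr s b q].
have le_nn : n * n <= B.
  by apply: leq_trans T_le; have [_ _ + _] := T_ge; apply: leq_trans; rewrite leq_pmull.
have tf : tri B encode s (n * n * (csize encode_cell + 40) + 40)
    (fun s' => I (n * n) s' /\ var s' v_p = n * n).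
  apply: tri_for => //; first exact: par_nn.
  move=> i s' lt_i ag vp bs [I1 I2 I3].
  have ps' : par s' by apply: par_agree ag ps.
  have vs : var s' v_s = sc by case: ag => ->.
  have vg : var s' v_g = g by case: ag => ->.
  have Istep va A ev : (forall b, b != a_Z -> A b = arr s' b) ->
      (forall p, p != i -> A a_Z p = arr s' a_Z p) ->
      powers sc (arr s' a_D) (A a_Z) i -> ev = enc n r sc (arr s' a_D i) ->
      I i.+1 (Store va (upd (upd A 12 (upd (A 12) (i * G + g) ev)) 14
                            (upd (A 14) (i * G + g) ev))).
    move=> A_ne AZ powi evE; split=> /=.
    - move=> p lt_p; rewrite A_ne // ltnS leq_eqVlt.
      have [->|ne_p] := eqVneq p i; first exact: powi.
      by move=> a Dp /= le_a; rewrite AZ //; apply: I1.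
    - move=> p; rewrite ltnS leq_eqVlt /encoded /= !A_ne // => lt_p.
      have [->|ne_p] := eqVneq p i; first by rewrite eqxx.
      rewrite (negPf ne_p) /= in lt_p; have [c12 c14] := I2 p lt_p.
      by rewrite !(eq_addr lt_gG) (negPf ne_p).
    - move=> b q b12 q_ne; rewrite -I3 //; last by move=> p lt_p; apply/q_ne/ltnW.
      have /negPf q_i := q_ne i (ltnSn i).
      by case: b12 => ->; rewrite /= q_i A_ne.
  have I1i := I1 i lt_i; rewrite ltnn in I1i.
  apply: wp_tri; rewrite /encode_cell /=.
  rewrite vp vs vg (par_r ps') (par_n ps') (par_G ps') (par_Xr ps') eqxx.
  split=> //; split; last first.
    move=> D0; do 2!split=> //; apply: Istep => //; last by rewrite D0.
    by move=> a; rewrite D0.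
  case Di : (arr s' 5 i) => [//|a] _; rewrite subn1 /=.
  have leaB : a %/ sc <= B.
    by apply: leq_trans (leq_div _ _) _; have [_ /(_ 5 i)] := bs; rewrite Di => /ltnW.
  split=> //; split; last first.
    move=> big_a; do 2!split=> //; apply: Istep => //.
      by move=> c; rewrite Di => -[<-] le_c; move: big_a; clear -le_c; lia.
    by rewrite Di /= ifF //; move: big_a; clear; lia.
  move=> small; have {small} le_a : a %/ sc <= r by move: small; clear; lia.
  have Zi : arr s' 6 i = X ^ (a %/ sc %/ 2).
    rewrite (I1i a Di) divnMA //; apply: leq_trans le_a; exact: leq_div.
  set q := a %/ sc in le_a leaB Zi *.
  (* The last factor is [X] raised to the parity of [q], because [X = 1 + n]. *)
  have Znew : arr s' 6 i * arr s' 6 i * (1 + (q - q %/ 2 * 2) * n) = X ^ q.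
    have -> : q - q %/ 2 * 2 = q %% 2 by rewrite {1}(divn_eq q 2) addKn.
    rewrite Zi -expnD addnn -muln2 [in RHS](divn_eq q 2) expnD.
    by congr (_ * _); rewrite modn2; case: (odd q); rewrite ?mul1n ?mul0n ?X_def.
  rewrite Znew.
  have ZB : X ^ q <= B.
    by apply: leq_trans Xr_le; rewrite Xr_def leq_exp2l // X_gt1.
  have eB : Xr %/ X ^ q <= B by apply: leq_trans (leq_div _ _) Xr_le.
  do 4!split=> //; apply: Istep.
  - by case=> [|[|[|[|[|[|[|]]]]]]].
  - by move=> p /negPf /= ->.
  - by move=> c; rewrite Di => -[<-] _ /=; rewrite eqxx.
  - rewrite Di /= -/q le_a Xr_def -X_def -{1}(subnK le_a) expnD mulnK //.
    by rewrite expn_gt0 X_def.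
apply: tri_post tf _ => s' [[I1 I2 I3] _]; split=> // p lt_p.
by have := I1 p lt_p; rewrite lt_p.
Qed.

Lemma M_gt0 : 0 < M.
Proof. by rewrite M_def !muln_gt0 Xr_gt0 X_def. Qed.

(** The cleared memory with both operands in place represents [matmul_input]. The computed and the
    true entry are congruent modulo [M] and both below [M], hence equal. *)
Lemma tri_scmd s g (f : nat -> nat) :
  var s v_M = M -> var s v_G = G -> var s v_g = g -> g < G ->
  (forall x, arr s 10 (x * G + g) = upd (fun=> 0) 0 n x) ->
  (forall b i, arr s (b.*2 + 11) (i * G + g) = 0) ->
  (forall b i, arr s (b.*2 + 12) (i * G + g) =
     if (b <= 1) && (i < n * n) then f i else 0) ->
  (forall i, i < n * n -> f i < M) ->
  (forall x y : 'I_n, \sum_(z < n) f (x * n + z) * f (z * n + y) < M) ->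
  tri B (scmd P) s (csize (scmd P) * tau) (fun s' => outside G g s s' /\
    forall x y : 'I_n, arr s' 16 ((x * n + y) * G + g) =
      \sum_(z < n) f (x * n + z) * f (z * n + y)).
Proof.
move=> sM sG sg lt_gG s10 s11 s12 f_lt sum_lt bs.
pose A : 'M[int]_n := (\matrix_(i < n, j < n) (f (i * n + j)%N)%:Z)%R.
have [t [a [rP prod le_t]]] := matmulP A A.
have sa : sim G g M s (matmul_input A A).
  split=> // b i; rewrite s12; first by case: ifP => [/andP[_ /f_lt]|] // _; exact: M_gt0.
  exists 0%R; rewrite mul0r addr0 /=; case: b => [|[|b]] //=.
  - case: ltnP => [/flat_cell[x [y ->]]|le_i]; last by rewrite flat_out.
    by rewrite flat_ord mxE.
  - case: ltnP => [/flat_cell[x [y ->]]|le_i]; last by rewrite flat_out.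
    by rewrite flat_ord mxE.
have [tm [s' [r' le_tm bs' sa' out]]] :=
  sim_run lt_gG M_gt0 le_MB le_capB rP sa bs.
exists tm, s'; split=> //.
  by apply: leq_trans le_tm _; rewrite leq_mul2r leq_mul2l le_t !orbT.
split=> // x y; have [m /eqP] := sim_entry sa' 2 (x * n + y).
rewrite prod mxE; under eq_bigr do rewrite !mxE -PoszM.
rewrite -(big_morph Posz PoszD erefl); have := sim_lt sa' 2 (x * n + y).
rewrite -[2.*2 + 12]/16; move: (sum_lt x y).
set S := \sum_(z < n) _; move: (arr s' 16 _) => v lt_S lt_v /eqP eq_S.
have m0 : m = 0%R by clear -eq_S lt_S lt_v; nia.
by move: eq_S; rewrite m0 mul0r addr0 => -[].
Qed.

Lemma nn_le : n * n <= B.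
Proof.
by apply: leq_trans T_le; have [_ _ + _] := T_ge; apply: leq_trans; rewrite leq_pmull.
Qed.

Lemma tri_collect s sc g : par s -> var s v_s = sc -> var s v_g = g ->
  tri B collect s (n * n * (csize collect_cell + 40) + 40) (fun s' =>
    forall p, p < n * n -> let u := arr s 16 (p * G + g) in
      arr s' a_V p = (if Xr <= u then u else arr s a_V p) /\
      arr s' a_S p = (if Xr <= u then sc else arr s a_S p)).
Proof.
move=> ps sE gE.
pose I i s' := forall p, let u := arr s 16 (p * G + g) in
  arr s' a_V p = (if (p < i) && (Xr <= u) then u else arr s a_V p) /\
  arr s' a_S p = (if (p < i) && (Xr <= u) then sc else arr s a_S p).
have tf : tri B collect s (n * n * (csize collect_cell + 40) + 40)
    (fun s' => I (n * n) s' /\ var s' v_p = n * n).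
  apply: tri_for => //; [exact: par_nn | exact: nn_le |].
  move=> i s' lt_i ag vp bs Ii.
  have ps' : par s' by apply: par_agree ag ps.
  have vs : var s' v_s = sc by case: ag => ->.
  have vg : var s' v_g = g by case: ag => ->.
  have a16 : arr s' 16 = arr s 16 by case: ag => _ ->.
  apply: wp_tri; rewrite /collect_cell /=.
  rewrite vp vs vg (par_G ps') (par_Xr ps') a16.
  have [bv ba] := bs; have := ba 16 (i * G + g); rewrite a16 => uB.
  have scB : sc <= B by rewrite -vs.
  split=> //; split.
    move=> acc; have {acc} le_u : Xr <= arr s 16 (i * G + g) by move: acc; clear; lia.
    do 2!split=> //; move=> p /=; have [V_p S_p] := Ii p; rewrite ltnS.
    have [->|ne_p] := eqVneq p i; first by rewrite leqnn le_u.
    by rewrite V_p S_p (leq_eqVlt p i) (negPf ne_p).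
  move=> rej p /=; have {rej} lt_u : (Xr <= arr s 16 (i * G + g)) = false.
    by move: rej; clear; lia.
  have [V_p S_p] := Ii p; rewrite V_p S_p ltnS (leq_eqVlt p i).
  by have [->|ne_p] := eqVneq p i; rewrite /= ?lt_u ?andbF.
by apply: tri_post tf _ => s' [Is _] p lt_p; have := Is p; rewrite lt_p.
Qed.

(** The calls numbered above [g] find their memory cleared. *)
Definition fresh (g : nat) (s : store) : Prop :=
  forall b q, 10 <= b -> g < q %% G -> arr s b q = 0.

Definition best (lo : nat) (D V S : nat -> nat) : Prop :=
  forall x y : 'I_n, let p := x * n + y in
  (V p = 0 /\ forall i, lo <= i < 2 * K -> encprod r D (2 ^ i) x y < Xr) \/
  (exists i, [/\ lo <= i < 2 * K, S p = 2 ^ i, V p = encprod r D (2 ^ i) x y,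
     Xr <= V p & forall j, lo <= j < i -> encprod r D (2 ^ j) x y < Xr]).

Record scale_inv (lo g : nat) (D : nat -> nat) (s : store) : Prop := ScaleInv {
  si_par : par s;
  si_s : var s v_s = 2 ^ lo;
  si_g : var s v_g = g;
  si_fresh : fresh g s;
  si_D : arr s a_D = D;
  si_pow : forall p, p < n * n -> powers (2 ^ lo) D (arr s a_Z) p;
  si_best : best lo D (arr s a_V) (arr s a_S) }.

Definition scale_cost : nat :=
  csize (v_s <~ Var v_s /' Const 2;; v_g <~ Var v_g +' Const 1) +
  (n * n * (csize encode_cell + 40) + 40 +
   (csize (put 10 (Var v_g) (Var v_n)) +
    (csize (scmd P) * tau + (n * n * (csize collect_cell + 40) + 40)))).

Lemma best_step lo D V S V' S' : lo < 2 * K -> best lo.+1 D V S ->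
  (forall x y : 'I_n, let p := x * n + y in let u := encprod r D (2 ^ lo) x y in
    V' p = (if Xr <= u then u else V p) /\
    S' p = (if Xr <= u then 2 ^ lo else S p)) ->
  best lo D V' S'.
Proof.
move=> lt_lo bst VS' x y p; have [V'p S'p] := VS' x y.
rewrite /p V'p S'p; case: leqP => [acc|rej].
  right; exists lo; split=> //; first by rewrite leqnn.
  by move=> j; case: ltngtP.
have step j : lo <= j -> (j = lo) \/ lo < j by case: ltngtP => // [|->]; auto.
have [[V0 rej']|[i [/andP[lo_i iK] Sp Vp acc rej']]] := bst x y; [left|right].
  by split=> // i /andP[/step[->//|lo_i] iK]; apply: rej'; rewrite lo_i.
exists i; split=> //; first by rewrite (ltnW lo_i).
by move=> j /andP[/step[->//|lo_j] ji]; apply: rej'; rewrite lo_j.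
Qed.

Lemma tri_scale lo g D s : lo < 2 * K -> g.+1 < G -> scale_inv lo.+1 g D s ->
  tri B (scale P) s scale_cost (scale_inv lo g.+1 D).
Proof.
move=> lt_lo lt_gG [ps sE gE fr DE pw bst].
have GB : g.+1 <= B.
  apply: leq_trans T3_le; have := K_ge; have lt_K : K < T by rewrite T_def ltn_expl.
  move: lt_gG; rewrite G_def; have := T_ge16; clear -lt_K; nia.
rewrite /scale_cost; apply: tri_seq_wp; rewrite /= sE gE addn1.
have -> : 2 ^ lo.+1 %/ 2 = 2 ^ lo by rewrite expnS mulKn.
have loB : 2 ^ lo <= B.
  apply: (@leq_trans (T * T)); first by rewrite T_def -expnD leq_exp2l; lia.
  by apply: leq_trans T3_le; rewrite leq_pmulr // T_gt0.
do 2!split=> //; set s1 := Store _ _.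
have ps1 : par s1 by case: ps.
have pw1 p : p < n * n -> powers (2 ^ lo * 2) (arr s1 a_D) (arr s1 a_Z) p.
  by rewrite -expnSr DE; apply: pw.
apply: tri_seq_agree (tri_encode ps1 erefl erefl lt_gG pw1) _.
rewrite [var s1 v_g]/= [var s1 v_s]/= => s2 ag2 [pw2 enc2 ne2].
have ps2 : par s2 by apply: par_agree ag2 ps1.
have g2 : var s2 v_g = g.+1 by case: ag2 => ->.
have sc2 : var s2 v_s = 2 ^ lo by case: ag2 => ->.
have arr2 b : b \notin [:: 6; 12; 14] -> arr s2 b = arr s b.
  by case: ag2 => _ a2 nb; rewrite a2.
have D2 : arr s2 a_D = D by rewrite arr2.
apply: tri_seq_wp; rewrite /= g2 (par_n ps2); split.
  apply: leq_trans nn_le; exact: leq_pmulr.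
set s3 := Store _ _.
have ps3 : par s3 by case: ps2.
have mod_g p : (p * G + g.+1) %% G = g.+1 by rewrite modnMDl modn_small.
have ne_cell p q : q %% G != g.+1 -> q != p * G + g.+1.
  by apply: contraNN => /eqP ->; rewrite mod_g.
have U_eq (x y : 'I_n) : \sum_(z < n) enc n r (2 ^ lo) (D (x * n + z)) *
    enc n r (2 ^ lo) (D (z * n + y)) = encprod r D (2 ^ lo) x y by [].
pose f p := enc n r (2 ^ lo) (D p).
have le_f p : f p <= Xr by rewrite Xr_def X_def enc_le.
apply: tri_seq_agree (@tri_scmd s3 g.+1 f _ _ _ _ _ _ _ _ _) _ => //.
- exact: par_M ps3.
- exact: par_G ps3.
- move=> x /=; have [->|x0] := eqVneq x 0; first by rewrite mul0n add0n eqxx.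
  rewrite -[X in _ == X]add0n -[X in _ == X + _](mul0n G) eq_addr // (negPf x0).
  by rewrite arr2 // fr // mod_g.
- move=> b i /=; case: eqP => [|_]; first by clear; lia.
  rewrite arr2; last by rewrite !inE; clear; lia.
  by rewrite fr ?mod_g //; clear; lia.
- move=> b i /=; case: eqP => [|_]; first by clear; lia.
  case: b => [|[|b]] /=.
  + case: ltnP => [lt_i|le_i]; first by have [+ _] := enc2 i lt_i; rewrite /encoded D2.
    rewrite ne2; [by rewrite /= fr // mod_g|by left|].
    by move=> p lt_p; rewrite eq_addr //; apply: contraTneq lt_p => <-; rewrite -leqNgt.
  + case: ltnP => [lt_i|le_i]; first by have [_] := enc2 i lt_i; rewrite /encoded D2.
    rewrite ne2; [by rewrite /= fr // mod_g|by right|].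
    by move=> p lt_p; rewrite eq_addr //; apply: contraTneq lt_p => <-; rewrite -leqNgt.
  + rewrite arr2; last by rewrite !inE; clear; lia.
    by rewrite fr ?mod_g //; clear; lia.
- move=> i _; apply: leq_ltn_trans (le_f i) _.
  by rewrite M_def -mulnA ltn_Pmulr ?Xr_gt0 // (leq_trans X_gt1) // leq_pmull ?Xr_gt0.
- by move=> x y; rewrite U_eq M_def Xr_def X_def encprod_lt.
move=> s4 _ [[v4 a4] prod4].
have arr4 b : b < 10 -> arr s4 b = arr s3 b.
  by move=> lt_b; apply/funext => q; apply: a4; rewrite lt_b.
have ps4 : par s4.
  by case: ps3 => *; split; rewrite ?v4 // => j le_j; rewrite arr4 // ; auto.
have g4 : var s4 v_g = g.+1 by rewrite v4.
have sc4 : var s4 v_s = 2 ^ lo by rewrite v4.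
apply: tri_post (tri_agree (tri_collect ps4 sc4 g4)) _ => s5 [ag5 VS5].
have arr5 b : b \notin [:: 7; 8] -> arr s5 b = arr s4 b.
  by case: ag5 => _ a5 nb; rewrite a5.
have D5 : arr s5 a_D = D by rewrite arr5 // arr4.
split=> //.
- by apply: par_agree ag5 ps4.
- by case: ag5 => ->.
- by case: ag5 => ->.
(* Operands, dimension and the call itself were all written at residue [g.+1] modulo [G]; cells of
   larger residue are still zero. *)
- move=> b q b10 lt_q; rewrite arr5; last by rewrite !inE; clear -b10; lia.
  have ne_q : q %% G != g.+1 by rewrite gtn_eqF.
  rewrite a4 ?ne_q ?orbT //= .
  have -> : (if b == 10 then upd (arr s2 10) g.+1 n else arr s2 b) q = arr s2 b q.
    case: eqP => [->|//] /=; rewrite ifF //; apply/negbTE.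
    by rewrite -[g.+1]add0n -(mul0n G) ne_cell.
  have [b_in|b_out] := boolP (b \in [:: 12; 14]).
    rewrite ne2 /=; first by rewrite fr // ltnW.
      by move: b_in; rewrite !inE => /orP[/eqP|/eqP]; auto.
    by move=> p _; apply: ne_cell.
  rewrite arr2 ?fr //; first exact: ltnW.
  by move: b_out; rewrite !inE; clear -b10; lia.
- by move=> p lt_p; rewrite arr5 // arr4 //= -D2; apply: pw2.
- apply: best_step bst _ => // x y p u; have [-> ->] := VS5 p (lt_cell x y).
  by rewrite {1}/p prod4 U_eq !arr4 //= !arr2.
Qed.

(** * Decoding by binary search for the exponent *)

Definition decode_cost : nat :=
  csize (v_u <~ Read a_V (Var v_p) /' Var v_Xr;;
         v_v <~ Var v_r;; v_q <~ Const 2 *' Var v_r) +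
  (rho.+1 * (csize decode_digit + 40) + 40 +
   csize (put a_D (Var v_p) (Read a_S (Var v_p) *' Var v_v +' Const 1))).

Lemma rho_le : rho.+1 <= r. Proof. by rewrite r_def ltn_expl. Qed.

Lemma tri_decode_cell s p v : par s -> var s v_p = p -> v <= r ->
  X ^ (r - v) * Xr <= arr s a_V p < X ^ (r - v).+1 * Xr ->
  arr s a_S p <= T * T ->
  tri B decode_cell s decode_cost (fun s' =>
    arr s' a_D = upd (arr s a_D) p (arr s a_S p * v + 1)).
Proof.
move=> ps vp le_v /andP[V_ge V_lt] leS bs.
have [bv ba] := bs.
have r2B : 2 * r <= B.
  apply: leq_trans T3r_le; rewrite leq_mul2r; apply/orP; right.
  by have := T_ge16; clear; nia.
move: bs; rewrite /decode_cost; apply: tri_seq_wp; rewrite /= (par_Xr ps) (par_r ps) vp.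
split; first exact: leq_trans (leq_div _ _) (ba _ _).
split; first exact: r_le.
split=> //; set s1 := Store _ _.
have ps1 : par s1 by case: ps.
(* [x] is the part of the exponent [r - v] not yet subtracted from [v_v]. It starts below [2 * r]
   and ends below 1, when [v_v] equals [v]. *)
pose I j s' := exists x, [/\ X ^ x <= var s' v_u < X ^ x.+1, var s' v_v = v + x,
  x < 2 ^ (rho.+1 - j) & var s' v_q = 2 ^ (rho.+1 - j)].
have tf : tri B (For v_j v_b decode_digit) s1 (rho.+1 * (csize decode_digit + 40) + 40)
    (fun s' => I rho.+1 s' /\ var s' v_j = rho.+1).
  apply: tri_for => //; [exact: par_b ps1|exact: leq_trans rho_le r_le| |].
    exists (r - v); rewrite /= subn0 leq_divRL ?Xr_gt0 // V_ge ltn_divLR ?Xr_gt0 // V_lt.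
    rewrite subnKC // expnS -r_def; split=> //.
    by have [_ + _] := r_ge; clear; lia.
  move=> j s' lt_j ag vj bs' [x [/andP[u_ge u_lt] vE lt_x qE]].
  have ps' : par s' by apply: par_agree ag ps1.
  have [bv' ba'] := bs'.
  apply: wp_tri; rewrite /decode_digit /= (par_rho ps') vj (par_pow ps') ?leq_subr //.
  have hE : 2 ^ (rho.+1 - j) = 2 * 2 ^ (rho - j) by rewrite subSn // expnS.
  rewrite qE hE mulKn //; rewrite hE in lt_x.
  set h := 2 ^ (rho - j) in lt_x *.
  have hB : h <= B.
    apply: leq_trans r_le; rewrite /h r_def leq_exp2l //; exact: leq_subr.
  have Xpos : 0 < X ^ h by rewrite expn_gt0 X_def.
  split=> //; split=> [acc|rej].
    have {acc} le_u : X ^ h <= var s' 17 by move: acc; clear; lia.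
    have le_hx : h <= x.
      by have := leq_ltn_trans le_u u_lt; rewrite ltn_exp2l ?X_gt1.
    split; first exact: leq_trans (leq_div _ _) (bv' _).
    split; first by apply: leq_trans (leq_subr _ _) (bv' _).
    exists (x - h); rewrite /= subSS vE leq_divRL // ltn_divLR // -!expnD subnK //.
    by rewrite addSn subnK // u_ge u_lt; split=> //; clear -le_hx lt_x; lia.
  have {rej} lt_u : var s' 17 < X ^ h by move: rej; clear; lia.
  exists x; rewrite /= subSS u_ge u_lt; split=> //.
  by have := leq_ltn_trans u_ge lt_u; rewrite ltn_exp2l ?X_gt1.
apply: tri_seq_agree tf _ => s' ag [[x [_ vE lt_x _]] _].
have {vE} vE : var s' v_v = v.
  by move: lt_x; rewrite subnn expn0 ltnS leqn0 vE => /eqP ->; rewrite addn0.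
have [v' a'] := ag; apply: wp_tri => /=; rewrite vE !v' // !a' //= vp; split=> //.
apply: leq_trans T3r_le; rewrite addn1.
have leSr : arr s 8 p * v <= T * T * r by rewrite leq_mul.
have : 0 < T * T * r.
  by rewrite !muln_gt0 T_gt0; have [_ + _] := r_ge; clear; lia.
by have := T_ge16; move: leSr; move: (arr s 8 p * v) => z; clear; nia.
Qed.

Lemma tri_decode s D : par s -> arr s a_D = D -> best 0 D (arr s a_V) (arr s a_S) ->
  tri B decode s (n * n * ((ecost (Read a_V (Var v_p)) +
      (decode_cost + csize (put a_D (Var v_p) (Const 0)))) + 40) + 40)
    (fun s' => scaled_square n r D (2 * K) (arr s' a_D)).
Proof.
move=> ps DE bst.
pose good q d := forall x y : 'I_n, q = x * n + y ->
  (d = 0 /\ forall i, i < 2 * K -> encprod r D (2 ^ i) x y < X ^ r) \/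
  (exists i v, [/\ i < 2 * K, d = (2 ^ i * v).+1, v <= r,
     forall j, j < i -> encprod r D (2 ^ j) x y < X ^ r
   & X ^ (r - v) * X ^ r <= encprod r D (2 ^ i) x y < X ^ (r - v).+1 * X ^ r]).
pose I i s' := forall q, q < i -> good q (arr s' a_D q).
set N := _ + (decode_cost + _).
have tf : tri B decode s (n * n * (N + 40) + 40)
    (fun s' => I (n * n) s' /\ var s' v_p = n * n).
  apply: tri_for => //; [exact: par_nn | exact: nn_le |].
  move=> i s' lt_i ag vp bs Ii.
  have ps' : par s' by apply: par_agree ag ps.
  have Istep va A d : (forall q, q != i -> A a_D q = arr s' a_D q) ->
      A a_D i = d -> good i d -> I i.+1 (Store va A).
    move=> A_ne A_i good_i q; rewrite ltnS (leq_eqVlt q i) /=.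
    have [-> _|ne_q /= lt_q] := eqVneq q i; first by rewrite A_i.
    by rewrite A_ne //; apply: Ii.
  have [x0 [y0 iE]] := flat_cell lt_i.
  have uniq_xy (x y : 'I_n) : i = x * n + y -> x0 = x /\ y0 = y.
    move=> iE'; have := congr1 (divn^~ n) iE'; have := congr1 (modn^~ n) iE'.
    rewrite iE !modnMDl !divnMDl // !divn_small // !addn0 !modn_small //.
    by move=> /val_inj -> /val_inj ->.
  have V' : arr s' a_V = arr s a_V by case: ag => _ ->.
  have S' : arr s' a_S = arr s a_S by case: ag => _ ->.
  apply: tri_if; rewrite /= vp V'.
    move=> V_ne; have := bst x0 y0; rewrite -iE /=.
    case=> [[V0 _]|[j [lt_j S_i V_i acc rej]]]; first by rewrite V0 in V_ne.
    have := acc; rewrite V_i Xr_def X_def => /encprod_decode [v [le_v dec _ _]].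
    apply: tri_mono (@tri_decode_cell s' i v _ _ _ _ _) (leq_addr _ _) _ => //.
    - by rewrite V' V_i Xr_def X_def.
    - by rewrite S' S_i T_def -expnD leq_exp2l //; clear -lt_j; lia.
    case=> va A /= AE; apply: Istep erefl _; rewrite AE /=.
      by move=> q /negPf ->.
    rewrite eqxx S' S_i addn1 => x y /uniq_xy [<- <-]; right; exists j, v.
    split=> //; last by rewrite X_def.
    by move=> j' lt_j'; rewrite -Xr_def rej.
  move=> V0; apply: tri_mono (wp_tri _) (leq_addl _ _) (fun _ => id) => /=.
  rewrite vp; split=> //; apply: Istep => [q /negPf /= -> //||] /=; first by rewrite eqxx.
  move=> x y /uniq_xy [<- <-]; left; split=> // j lt_j.
  have := bst x0 y0; rewrite -iE /=.
  case=> [[_ rej]|[j' [_ _ _ acc _]]]; first by rewrite -Xr_def rej.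
  by rewrite V0 leqNgt Xr_gt0 in acc.
apply: tri_post tf _ => s' [Is _] x y.
by have := Is _ (lt_cell x y) x y erefl; rewrite X_def.
Qed.

(** * One approximate squaring *)

Definition square_cost : nat :=
  (n * n * (csize reset_cell + 40) + 40) +
  (csize (v_s <~ Var v_T *' Var v_T) +
   ((2 * K * (ecost (Var v_s -' Const 1) + scale_cost) + ecost (Var v_s -' Const 1)) +
    (n * n * ((ecost (Read a_V (Var v_p)) +
      (decode_cost + csize (put a_D (Var v_p) (Const 0)))) + 40) + 40))).

Record level_inv (i : nat) (s : store) : Prop := LevelInv {
  li_par : par s;
  li_g : var s v_g = 2 * K * i;
  li_fresh : fresh (2 * K * i) s;
  li_level : level e w r i (arr s a_D) }.

Lemma tri_square i s : i < K -> level_inv i s ->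
  tri B (square P) s square_cost (level_inv i.+1).
Proof.
move=> lt_iK [ps gE fr lev].
pose I j s' := forall p, p < j -> arr s' a_V p = 0 /\ arr s' a_Z p = 1.
have tf : tri B (For v_p v_nn reset_cell) s (n * n * (csize reset_cell + 40) + 40)
    (fun s' => I (n * n) s' /\ var s' v_p = n * n).
  apply: tri_for => //; [exact: par_nn | exact: nn_le |].
  move=> j s' lt_j ag vp _ Ij; apply: wp_tri; rewrite /= vp.
  split=> //; split=> [|p /=]; first by rewrite (leq_trans _ T_le) ?T_gt0.
  rewrite ltnS (leq_eqVlt p j); case: eqVneq => //= _.
  exact: Ij.
apply: tri_seq_agree tf _ => s1 ag1 [reset _].
have ps1 : par s1 by apply: par_agree ag1 ps.
have g1 : var s1 v_g = 2 * K * i by case: ag1 => ->.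
have arr1 b : b \notin [:: 6; 7] -> arr s1 b = arr s b.
  case: ag1 => _ a1; rewrite !inE => nb; apply: a1.
  by rewrite /= !inE orbC.
have TTB : T * T <= B by apply: leq_trans T3_le; rewrite leq_pmulr ?T_gt0.
apply: tri_seq_wp; rewrite /= (par_T ps1); split=> //.
set s2 := Store _ _.
set D := arr s a_D in lev.
pose J m := scale_inv (2 * K - m) (2 * K * i + m) D.
have leK m : m < 2 * K -> 2 * K * i + m.+1 <= 2 * K * K.
  have : 2 * K * i.+1 <= 2 * K * K by rewrite leq_mul2l lt_iK orbT.
  by rewrite mulnS; clear; lia.
(* Entries are at most [T * W + 1 <= T * T / 2], so [2 * K] scales suffice. *)
have levD (x y : 'I_n) : D (x * n + y) <= 2 ^ (2 * K).-1.
  apply: leq_trans (level_bound x y lev) _; rewrite -W_def.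
  apply: (@leq_ltn_trans (T * W)).
    by rewrite leq_mul2r T_def leq_exp2l // (ltnW lt_iK) orbT.
  rewrite -(ltn_pmul2l (isT : 0 < 2)) -expnS prednK; last by have := K_ge; clear; lia.
  have -> : 2 ^ (2 * K) = T * T by rewrite [2 * K]mul2n -addnn expnD -T_def.
  by have [+ _ _ _] := T_ge; have := T_gt0; clear -W_gt0; nia.
have Dlt p a : p < n * n -> D p = a.+1 -> a < 2 ^ (2 * K).
  move=> /flat_cell[x [y ->]] Dxy; have := levD x y; rewrite Dxy => /leq_trans; apply.
  by rewrite leq_exp2l // leq_pred.
have J0 : J 0 s2.
  rewrite /J subn0 addn0; split=> //.
  - by case: ps1.
  - by rewrite /= T_def -expnD addnn mul2n.
  - by move=> b q b10 lt_q; rewrite /= arr1 ?fr // !inE; clear -b10; lia.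
  - by rewrite /= arr1.
  - move=> p lt_p a /(Dlt _ _ lt_p) lt_a _; have [_ ->] := reset p lt_p.
    by rewrite divn_small.
  - move=> x y; left; have [-> _] := reset _ (lt_cell x y); split=> // j.
    by move=> /andP[]; case: ltngtP.
have tw : tri B (While (Var v_s -' Const 1) (scale P)) s2
    (2 * K * (ecost (Var v_s -' Const 1) + scale_cost) + ecost (Var v_s -' Const 1))
    (J (2 * K)).
  apply: tri_while => //.
    move=> m s' lt_m _ _ Jm; split.
      rewrite /= (si_s Jm) subn_eq0 -ltnNge -[1]/(2 ^ 0) ltn_exp2l //.
      by rewrite subn_gt0.
    rewrite /J subnS addnS; apply: tri_scale.
    - by move: lt_m; clear; lia.
    - by rewrite G_def addn1 -addnS ltnS leK.
    - by rewrite prednK ?subn_gt0.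
  by move=> s' _ _ Jm; rewrite /= (si_s Jm) subnn.
apply: tri_seq_agree tw _ => s3 _ [ps3 _ g3 fr3 D3 _ bst].
rewrite subnn in bst.
apply: tri_post (tri_agree (tri_decode ps3 D3 bst)) _ => s4 [ag4 sq].
have gi : 2 * K * i + 2 * K = 2 * K * i.+1 by rewrite mulnS addnC.
split.
- by apply: par_agree ag4 ps3.
- by rewrite -gi; case: ag4 => ->.
- move=> b q b10 lt_q; case: ag4 => _ ->; first by rewrite fr3 // gi.
  by rewrite /= !inE; clear -b10; lia.
- apply: level_step lev _.
    by have [h _ _] := r_ge; move: h lt_iK; clear; lia.
  apply: (@scaled_squareP n r D (2 * K).-1) => //.
    by rewrite r_def oddX orbF; have := rho_gt0; case: (rho).
  by rewrite prednK //; have := K_ge; clear; lia.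
Qed.

(** * Setting up the parameters *)

Record start (s : store) : Prop := Start {
  st_n : var s v_n = n; st_nn : var s v_nn = n * n; st_W : var s v_W = W;
  st_K : var s v_K = 0; st_rho : var s v_rho = 0; st_g : var s v_g = 0;
  st_k : var s v_k = 0;
  st_e : forall x y : 'I_n, arr s 0 (x * n + y) = e x y;
  st_w : forall x y : 'I_n, arr s 1 (x * n + y) = if e x y then w x y else 0;
  st_digit0 : forall j, j < k -> arr s 2 j = 0;
  st_digit1 : arr s 2 k = 1;
  st_fresh : forall b q, 10 <= b -> arr s b q = 0 }.

Lemma E_le : E <= B.
Proof.
by apply: leq_trans T_le; have [_ + _ _] := T_ge; apply: leq_trans; rewrite leq_pmull.
Qed.

Definition double_cost (x y b : nat) (m : nat) : nat :=
  csize (x <~ Const 1) +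
  (m * (ecost (Var b -' Var x) +
        csize (x <~ Var x *' Const 2;; y <~ Var y +' Const 1)) +
   ecost (Var b -' Var x)).

Lemma tri_double x y b s v : x != y -> x != b -> y != b ->
  var s b = v -> var s y = 0 -> 2 ^ up_log 2 v <= B ->
  tri B (x <~ Const 1;;
         While (Var b -' Var x) (x <~ Var x *' Const 2;; y <~ Var y +' Const 1)) s
    (double_cost x y b (up_log 2 v))
    (fun s' => var s' x = 2 ^ up_log 2 v /\ var s' y = up_log 2 v).
Proof.
move=> /negPf xy /negPf xb /negPf yb sb sy leB.
have B_gt0 : 0 < B by apply: leq_trans leB; rewrite expn_gt0.
apply: tri_seq_wp; rewrite /=; split=> //; set s1 := Store _ _.
pose J j s' := var s' x = 2 ^ j /\ var s' y = j.
apply: (@tri_while B _ _ _ _ _ J).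
- by rewrite /J /= eqxx [y == x]eq_sym xy.
- move=> j s' lt_j [v' _] _ [xE yE].
  have bE : var s' b = v.
    by rewrite v' /= ?inE ?[b == _]eq_sym ?xb ?yb.
  have le_jB m : m <= up_log 2 v -> 2 ^ m <= B.
    by move=> le_m; apply: leq_trans leB; rewrite leq_exp2l.
  split.
    rewrite /= bE xE subn_eq0; apply/negP => /up_log_min.
    by move=> /(_ isT); rewrite leqNgt lt_j.
  apply: wp_tri; rewrite /= xE -expnSr le_jB //; split=> //.
  rewrite [y == x]eq_sym xy yE addn1.
  split; first by apply: leq_trans (le_jB _ lt_j); rewrite ltnW // ltn_expl.
  by rewrite /J /= eqxx xy eqxx.
- move=> s' [v' _] _ [xE _].
  have bE : var s' b = v.
    by rewrite v' /= ?inE ?[b == _]eq_sym ?xb ?yb.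
  by apply/eqP; rewrite /= bE xE subn_eq0 up_logP.
Qed.

Definition setup_E_cost : nat :=
  csize (v_E <~ Const 1) +
  (k * (ecost (Const 1 -' Read 2 (Var v_k)) +
        csize (v_k <~ Var v_k +' Const 1;; v_E <~ Var v_E *' Const 2)) +
   ecost (Const 1 -' Read 2 (Var v_k))).

Lemma tri_setup_E s : start s ->
  tri B setup_E s setup_E_cost (fun s' => var s' v_E = E).
Proof.
move=> st; have E_le := E_le; have E_gt0 := E_gt0.
apply: tri_seq_wp; rewrite /=; split; first exact: leq_trans E_gt0 E_le.
set s1 := Store _ _.
pose J j s' := var s' v_E = 2 ^ j /\ var s' v_k = j.
apply: (@tri_post _ _ _ _ (J k)) => [|s' [-> _] //].
apply: (@tri_while B _ _ _ _ _ J).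
- by split=> //=; rewrite (st_k st).
- move=> j s' lt_j [_ a'] _ [EE kE].
  have dig : arr s' 2 = arr s 2 by rewrite a'.
  split; first by rewrite /= dig kE (st_digit0 st lt_j).
  have le_jB : 2 ^ j.+1 <= B by apply: leq_trans E_le; rewrite E_def leq_exp2l.
  apply: wp_tri; rewrite /= EE kE -expnSr addn1; split=> //.
  by apply: leq_trans le_jB; rewrite ltnW // ltn_expl.
- move=> s' [_ a'] _ [_ kE].
  by rewrite /= kE a' // (st_digit1 st).
Qed.

Lemma Xpow_le j : j <= rho -> X ^ (2 ^ j) <= B.
Proof.
move=> le_j; apply: leq_trans Xr_le.
by rewrite Xr_def leq_exp2l ?X_gt1 // r_def leq_exp2l.
Qed.

Lemma tri_setup_pow s : var s v_n = n -> var s v_rho = rho ->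
  tri B setup_pow s (csize (put a_pow (Const 0) (Var v_n +' Const 1)) +
      (rho * (csize square_pow + 40) + 40))
    (fun s' => forall j, j <= rho -> arr s' a_pow j = X ^ (2 ^ j)).
Proof.
move=> sn srho; have rhoB : rho <= B by apply: leq_trans (ltnW rho_le) r_le.
apply: tri_seq_wp; rewrite /= sn addn1 -X_def; split; first exact: (@Xpow_le 0).
set s1 := Store _ _.
pose I i s' := forall j, j <= i -> arr s' a_pow j = X ^ (2 ^ j).
apply: (@tri_post _ _ _ _ (fun s' => I rho s' /\ var s' v_j = rho)) => [|s' [] //].
apply: tri_for => // [[|j] //|i s' lt_i _ vj _ Ii].
apply: wp_tri; rewrite /square_pow /= vj Ii // -expnD addnn -mul2n -expnS addn1.
split; first exact: Xpow_le.
move=> j; rewrite leq_eqVlt /= ltnS.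
by have [->|ne_j /= le_j] := eqVneq j i.+1; last exact: Ii.
Qed.

Lemma tri_init_D s : par s ->
  (forall x y : 'I_n, arr s 0 (x * n + y) = e x y) ->
  (forall x y : 'I_n, arr s 1 (x * n + y) = if e x y then w x y else 0) ->
  tri B init_D s (n * n * (csize init_cell + 40) + 40)
    (fun s' => level e w r 0 (arr s' a_D)).
Proof.
move=> ps s_e s_w.
pose I i s' := forall p, p < i -> arr s' a_D p = arr s 0 p * (arr s 1 p + 1).
have tf : tri B init_D s (n * n * (csize init_cell + 40) + 40)
    (fun s' => I (n * n) s' /\ var s' v_p = n * n).
  apply: tri_for => //; [exact: par_nn | exact: nn_le |].
  move=> i s' lt_i [v' a'] vp bs Ii.
  apply: wp_tri; rewrite /init_cell /= vp (a' 0 isT) (a' 1 isT); split.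
    have [x [y ->]] := flat_cell lt_i; rewrite s_e s_w addn1.
    case: ifP => exy; last by rewrite mul0n.
    rewrite mul1n; apply: leq_trans T_le.
    have [h _ _ _] := T_ge; have := le_max_weight w exy; rewrite -W_def.
    by clear -h W_gt0; lia.
  move=> p; rewrite ltnS (leq_eqVlt p i) /=.
  by have [->|ne_p /= lt_p] := eqVneq p i; last exact: Ii.
apply: tri_post tf _ => s' [Is _]; apply: level0 => x y.
rewrite Is ?lt_cell // s_e s_w.
by case: ifP => // _; rewrite addn1 mul1n.
Qed.

(** * Output, and the run for positive weights *)

Definition output_cost : nat :=
  n * (csize (v_d <~ Const 0) + ((n * (csize min_cell + 40) + 40) + csize write_cell) + 40)
  + 40.

Lemma tri_write_output s : par s -> level e w r K (arr s a_D) ->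
  (forall x : 'I_n, exists y : 'I_n, 0 < arr s a_D (x * n + y)) ->
  tri B write_output s output_cost (fun s' => forall x : 'I_n,
    arr s' a_den x = (r - 4 * K) * (T - n) /\
    exists d, [/\ exists y : 'I_n, arr s a_D (x * n + y) = d.+1,
      forall (y : 'I_n) a, arr s a_D (x * n + y) = a.+1 -> d <= a
    & arr s' a_num x = if 2 * n * W < d then d * r else 0]).
Proof.
move=> ps lev fin; set D := arr s a_D in lev fin *.
pose good (x : nat) (s' : store) := arr s' a_den x = (r - 4 * K) * (T - n) /\
    exists d, [/\ exists y : 'I_n, D (x * n + y) = d.+1,
      forall (y : 'I_n) a, D (x * n + y) = a.+1 -> d <= a
    & arr s' a_num x = if 2 * n * W < d then d * r else 0].
pose I i s' := forall x, x < i -> good x s'.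
have nB : n <= B by apply: leq_trans nn_le; rewrite leq_pmulr.
have tf : tri B write_output s output_cost (fun s' => I n s' /\ var s' v_x = n).
  apply: tri_for => //; first exact: par_n.
  move=> i s' lt_i ag vx bs Ii.
  have ps' : par s' by apply: par_agree ag ps.
  have D' : arr s' a_D = D by case: ag => _ ->.
  apply: tri_seq_wp; rewrite /=; split=> //; set s1 := Store _ _.
  pose J j s2 := (var s2 v_d = 0 /\ forall y, y < j -> D (i * n + y) = 0) \/
    (exists2 y, y < j & D (i * n + y) = var s2 v_d) /\ 0 < var s2 v_d /\
      forall y, y < j -> 0 < D (i * n + y) -> var s2 v_d <= D (i * n + y).
  have tj : tri B (For v_j v_n min_cell) s1 (n * (csize min_cell + 40) + 40)
      (fun s2 => J n s2 /\ var s2 v_j = n).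
    apply: tri_for => //; [exact: (par_n ps') | by left |].
    move=> j s2 lt_j [v2 a2] vj [_ ba2] Jj.
    have D2 : arr s2 a_D = D by rewrite a2.
    apply: wp_tri; rewrite /min_cell /= vj (v2 v_x isT) (v2 v_n isT) D2 /= vx (par_n ps').
    have cellB : D (i * n + j) <= B by rewrite -D2.
    have ltS y : y < j.+1 -> y = j \/ y < j.
      by rewrite ltnS leq_eqVlt => /orP[/eqP|]; auto.
    do 2!split=> //.
      move=> upd_d; split=> //; rewrite /J /=; right.
      have h0 : 0 < D (i * n + j) by rewrite lt0n; apply: contraNneq upd_d => ->; rewrite mul0n.
      split; first by exists j.
      split=> // y /ltS[-> //|lt_y] Dy.
      case: Jj => [[_ /(_ y lt_y) D0]|[_ [d0 /(_ y lt_y Dy)]]]; first by rewrite D0 in Dy.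
      apply: leq_trans; rewrite leqNgt; apply/negP => lt_d; case/negP: upd_d.
      by rewrite muln_eq0; apply/orP; right; clear -d0 lt_d; lia.
    move=> keep; rewrite /J /=.
    case: Jj => [[d0 Dz]|[[y lt_y Dy] [d0 le_d]]].
      have D0 : D (i * n + j) = 0 by move: keep; rewrite d0; clear; nia.
      by left; split=> // y /ltS[-> //|]; apply: Dz.
    right; split; first by exists y => //; apply: ltnW.
    split=> // y' /ltS[->|lt_y']; last exact: le_d.
    by move=> D0; move: keep d0 D0; clear; nia.
  apply: tri_seq_agree tj _ => s2 ag2 [Jn _].
  have ps1 : par s1 by case: ps'.
  have ps2 : par s2 by apply: par_agree ag2 ps1.
  have x2 : var s2 v_x = i by case: ag2 => ->.
  have arr2 b : arr s2 b = arr s' b by case: ag2 => _ ->.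
  pose xi := Ordinal lt_i.
  have [y0 D0] := fin xi.
  have [d dE [[y1 Dy1] le_d]] : exists2 d, var s2 v_d = d.+1 &
      (exists y : 'I_n, D (i * n + y) = d.+1) /\
      forall (y : 'I_n) a, D (i * n + y) = a.+1 -> d <= a.
    case: Jn => [[_ /(_ y0 (ltn_ord y0)) Dz]|[[y lt_y Dy] [d0 le_d]]].
      by rewrite Dz in D0.
    exists (var s2 v_d).-1; first by rewrite prednK.
    split; first by exists (Ordinal lt_y); rewrite prednK //.
    move=> y' a Da; have := le_d y' (ltn_ord y'); rewrite Da => /(_ isT).
    by case: (var s2 v_d) d0.
  have dT : d <= T * T.
    have := level_bound xi y1 lev; rewrite /= Dy1 -T_def ltnS -W_def => /leq_trans; apply.
    by rewrite leq_mul2l; apply/orP; right; have [+ _ _ _] := T_ge; clear; lia.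
  apply: wp_tri; rewrite /write_cell /= x2 dE.
  rewrite (par_r ps2) (par_K ps2) (par_T ps2) (par_n ps2) (par_W ps2) !arr2.
  have rT : (r - 4 * K) * (T - n) <= B.
    apply: leq_trans T3r_le; rewrite mulnC leq_mul ?leq_subr //.
    apply: leq_trans (leq_subr _ _) _; rewrite -mulnA leq_pmulr // muln_gt0 T_gt0 //.
  have drB : d * r <= B.
    apply: leq_trans T3r_le; rewrite leq_mul2r; apply/orP; right.
    by apply: leq_trans dT _; rewrite leq_pmulr ?T_gt0.
  have Istep va A : (forall b x, x != i -> A b x = arr s' b x) ->
      A a_den i = (r - 4 * K) * (T - n) ->
      A a_num i = (if 2 * n * W < d then d * r else 0) -> I i.+1 (Store va A).
    move=> A_ne Aden Anum x; rewrite ltnS leq_eqVlt.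
    have [-> _|ne_x /= lt_x] := eqVneq x i.
      by split=> //=; exists d; split=> //; exists y1.
    by rewrite /good /= !A_ne //; apply: Ii.
  split=> //; split=> [big|small].
    split; first by rewrite subn1.
    apply: Istep => //=; rewrite ?eqxx //.
    - by case=> [|[|[|[|[|b]]]]] x /negPf ne_x; rewrite /= ?ne_x ?arr2.
    - by rewrite subn1 /= ifT //; move: big; clear; lia.
  split=> //; apply: Istep => //=; rewrite ?eqxx //.
  - by case=> [|[|[|[|[|b]]]]] x /negPf ne_x; rewrite /= ?ne_x ?arr2.
  - by rewrite ifF //; move: small; clear; lia.
by apply: tri_post tf _ => s' [Is _] x; apply: Is.
Qed.

Definition positive_cost : nat :=
  setup_E_cost +
  ((csize (v_b <~ Const 16 *' (Var v_n *' Var v_n) *' Var v_W *' Var v_E) +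
    double_cost v_T v_K v_b K) +
  ((csize (v_b <~ Const 16 *' Var v_K *' Var v_E) + double_cost v_r v_rho v_b rho) +
  ((csize (put a_pow (Const 0) (Var v_n +' Const 1)) +
      (rho * (csize square_pow + 40) + 40)) +
  (csize setup_mod +
  ((n * n * (csize init_cell + 40) + 40) +
  ((K * (square_cost + 40) + 40) + output_cost)))))).

(** The interface between program and error analysis: no machine state occurs in it any more. *)
Definition answer (x : 'I_n) (num den : nat) : Prop :=
  den = (r - 4 * K) * (T - n) /\
  exists d, [/\ forall p, path e x p -> size p = T -> d <= wt w x p,
    exists p, [/\ path e x p, size p = T & wt w x p * (r - 4 * K) <= r * d]
  & num = if 2 * n * W < d then d * r else 0].

Hypothesis out_edge : forall x : 'I_n, exists y, e x y.

Lemma level_answer D (x : 'I_n) d : level e w r K D ->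
  (exists y : 'I_n, D (x * n + y) = d.+1) ->
  (forall (y : 'I_n) a, D (x * n + y) = a.+1 -> d <= a) ->
  answer x (if 2 * n * W < d then d * r else 0) ((r - 4 * K) * (T - n)).
Proof.
move=> lev [y Dy] le_d; split=> //; exists d; split=> //.
- move=> p xp szp; rewrite T_def in szp.
  have [/(_ p xp szp erefl) [D0 le_p] _] := lev x (last x p).
  by apply: leq_trans le_p; apply: (le_d (last x p)); rewrite prednK.
- have [_ /(_ d Dy) [p [xp szp _ le_p]]] := lev x y.
  by exists p; rewrite T_def.
Qed.

Lemma tri_positive s : start s ->
  tri B (positive_case P) s positive_cost
    (fun s' => forall x : 'I_n, answer x (arr s' a_num x) (arr s' a_den x)).
Proof.
move=> st; have E_le := E_le; have T_le := T_le; have r_le := r_le.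
have leT := leT; have le_r := le_r.
apply: tri_seq_agree (tri_setup_E st) _ => s1 [v1 a1] E1.
apply: tri_seq_agree (_ : tri B setup_T s1 _
    (fun s' => var s' v_T = T /\ var s' v_K = K)) _.
  apply: tri_seq_wp; rewrite /= E1 !v1 // (st_n st) (st_W st).
  split; first exact: leq_trans leT T_le.
  rewrite T_def K_def; apply: tri_double => //=; first by rewrite v1 // (st_K st).
  by rewrite -K_def -T_def.
move=> s2 [v2 a2] [T2 K2].
apply: tri_seq_agree (_ : tri B setup_r s2 _
    (fun s' => var s' v_r = r /\ var s' v_rho = rho)) _.
  apply: tri_seq_wp; rewrite /= K2 (v2 v_E isT) E1.
  split; first exact: leq_trans le_r r_le.
  rewrite r_def rho_def; apply: tri_double => //=.
    by rewrite v2 // v1 // (st_rho st).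
  by rewrite -rho_def -r_def.
move=> s3 [v3 a3] [r3 rho3].
have n3 : var s3 v_n = n by rewrite v3 // v2 // v1 // (st_n st).
apply: tri_seq_agree (tri_setup_pow n3 rho3) _ => s4 [v4 a4] pow4.
apply: tri_seq_wp; rewrite /setup_mod /= (v4 v_rho isT) rho3 pow4 // -r_def -Xr_def.
rewrite (v4 v_n isT) n3 (v4 v_K isT) (v3 v_K isT) K2 !addn1 -X_def -M_def -addn1 -G_def.
have GB : G <= B.
  apply: leq_trans T3_le; have lt_K : K < T by rewrite T_def ltn_expl.
  by rewrite G_def; have := T_ge16; clear -lt_K; nia.
split; first exact: Xr_le. split=> //; split=> //.
split; first exact: leq_trans rho_le r_le.
set s5 := Store _ _.
have v4' x : x \notin [:: 3; 4; 5; 6; 7; 9; 19; 24; 25] -> var s4 x = var s x.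
  rewrite !inE !negb_or => /and5P[x3 x4 x5 x6 /and5P[x7 x9 x19 x24 x25]].
  by rewrite v4 ?v3 ?v2 ?v1 //= !inE !negb_or ?x3 ?x4 ?x5 ?x6 ?x7 ?x19 ?x24 ?x25.
have a4' b : b != a_pow -> arr s4 b = arr s b.
  by move=> b9; rewrite a4 ?a3 ?a2 ?a1 //= !inE negb_or b9.
have ps5 : par s5.
  split; rewrite //= ?(v4' v_n isT) ?(v4' v_nn isT) ?(v4' v_W isT).
  - exact: st_n.
  - exact: st_nn.
  - exact: st_W.
  - by rewrite v4 // v3.
  - by rewrite v4 // v3.
  - by rewrite v4.
  - by rewrite v4.
apply: tri_seq_agree (tri_init_D ps5 _ _) _ => [x y|x y|s6 ag6 lev6].
- by rewrite /= a4' // (st_e st).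
- by rewrite /= a4' // (st_w st).
have ps6 : par s6 by apply: par_agree ag6 ps5.
apply: tri_seq_agree (_ : tri B (For v_i v_K (square P)) s6 _
    (fun s' => level_inv K s' /\ var s' v_i = K)) _.
  apply: tri_for => //.
  - exact: par_K ps6.
  - by apply: leq_trans T_le; rewrite T_def ltnW // ltn_expl.
  - by rewrite /= modv_scmd.
  - by rewrite /= modv_scmd.
  - have [v6 a6] := ag6; split=> //; first by case: ps6.
      by rewrite /= v6 // muln0 /= v4' // (st_g st).
    move=> b q b10 _; rewrite /= a6 /= ?a4' ?(st_fresh st) //.
      by clear -b10; lia.
    by rewrite inE; clear -b10; lia.
  move=> i s' lt_i _ _ _ li; apply: tri_post (tri_square lt_i li) _ => s'' [[*] *].
  by split.
move=> s7 _ [[ps7 _ _ lev7] _].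
apply: tri_post (tri_write_output ps7 lev7 _) _ => [x|s' out x].
  have [p xp szp] := walk_exists out_edge x (2 ^ K).
  by exists (last x p); have [/(_ p xp szp erefl) [D0 _] _] := lev7 x (last x p).
have [-> [d [exy le_d ->]]] := out x.
exact: level_answer lev7 exy le_d.
Qed.

End Correctness.

(** * Running time and approximation ratio *)

Section Costs.

Variable P : arith_prog.

(** These rules follow the shape of a cost expression and build the constant on the way: it is left
    open by [eexists] and may depend on [P] only. *)
Lemma dom_add Z a b x y : x <= a * Z -> y <= b * Z -> x + y <= (a + b) * Z.
Proof. by rewrite mulnDl; apply: leq_add. Qed.

Lemma dom_const Z c : 0 < Z -> c <= c * Z.
Proof. exact: leq_pmulr. Qed.

Lemma dom_mul Y Z a b x y : x <= a * Y -> y <= b * Z -> x * y <= a * b * (Y * Z).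
Proof. by move=> hx hy; rewrite mulnACA leq_mul. Qed.

Lemma dom_mulr Z a x c : x <= a * Z -> x * c <= a * c * Z.
Proof. by move=> hx; rewrite mulnAC leq_mul2r hx orbT. Qed.

Lemma dom_mull Z a x c : x <= a * Z -> c * x <= c * a * Z.
Proof. by move=> hx; rewrite -mulnA leq_mul2l hx orbT. Qed.

Lemma scale_cost_le : exists c, forall n tau, 0 < n ->
  scale_cost n P tau <= c * (n * n + tau).
Proof.
eexists => n tau n_gt0; have Z0 : 0 < n * n + tau by rewrite addn_gt0 muln_gt0 n_gt0.
have hn : n * n <= 1 * (n * n + tau) by rewrite mul1n leq_addr.
have ht : tau <= 1 * (n * n + tau) by rewrite mul1n leq_addl.
apply: dom_add (dom_const _ Z0) _.
apply: dom_add (dom_add (dom_mulr _ hn) (dom_const _ Z0)) _.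
apply: dom_add (dom_const _ Z0) _.
exact: dom_add (dom_mull _ ht) (dom_add (dom_mulr _ hn) (dom_const _ Z0)).
Qed.

Lemma square_cost_le : exists c, forall n tau K rho, 0 < n -> 0 < K -> rho <= 3 * K ->
  square_cost n P tau K rho <= c * (K * (n * n + tau)).
Proof.
have [cs scaleP] := scale_cost_le.
eexists => n tau K rho n_gt0 K_gt0 le_rho; set Y := n * n + tau; set Z := K * Y.
have Y0 : 0 < Y by rewrite addn_gt0 muln_gt0 n_gt0.
have Z0 : 0 < Z by rewrite muln_gt0 K_gt0.
have hY : Y <= 1 * Z by rewrite mul1n leq_pmull.
have hn : n * n <= 1 * Z by apply: leq_trans hY; rewrite leq_addr.
have hnY : n * n <= 1 * Y by rewrite mul1n leq_addr.
have hK : K <= 1 * K by rewrite mul1n.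
have hrho : rho.+1 <= 4 * K by move: le_rho K_gt0; clear; lia.
apply: dom_add (dom_add (dom_mulr _ hn) (dom_const _ Z0)) _.
apply: dom_add (dom_const _ Z0) _.
apply: dom_add.
  apply: dom_add _ (dom_const _ Z0); apply: dom_mul (dom_mull _ hK) _.
  exact: dom_add (dom_const _ Y0) (scaleP _ _ n_gt0).
apply: dom_add _ (dom_const _ Z0); rewrite /Z [K * Y]mulnC.
apply: dom_mul hnY _; apply: dom_add (dom_const _ K_gt0).
apply: dom_add (dom_const _ K_gt0) _; apply: dom_add _ (dom_const _ K_gt0).
apply: dom_add (dom_const _ K_gt0) _.
apply: dom_add (dom_add (dom_mulr _ hrho) (dom_const _ K_gt0)) (dom_const _ K_gt0).
Qed.

Lemma positive_cost_le : exists c, forall n k tau K rho,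
  0 < n -> 0 < K -> k <= K -> rho <= 3 * K ->
  positive_cost n P k tau K rho <= c * (K * K * (n * n + tau)).
Proof.
have [cs squareP] := square_cost_le.
eexists => n k tau K rho n_gt0 K_gt0 le_k le_rho; set Y := n * n + tau.
set Z := K * K * Y.
have Y0 : 0 < Y by rewrite addn_gt0 muln_gt0 n_gt0.
have Z0 : 0 < Z by rewrite !muln_gt0 K_gt0.
have hYZ x : x <= 1 * Y -> x <= 1 * Z.
  rewrite !mul1n => /leq_trans; apply; by rewrite leq_pmull // muln_gt0 K_gt0.
have hn : n * n <= 1 * Z by apply: hYZ; rewrite mul1n leq_addr.
have hK : K <= 1 * Z by rewrite mul1n /Z -mulnA leq_pmulr // muln_gt0 K_gt0.
have hk : k <= 1 * Z := leq_trans le_k hK.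
have hrho : rho <= 3 * Z.
  by apply: leq_trans le_rho _; rewrite leq_mul2l /=; rewrite mul1n in hK.
have cZ c := dom_const c Z0.
have h1K : K <= 1 * K by rewrite mul1n.
apply: dom_add (dom_add (cZ _) (dom_add (dom_mulr _ hk) (cZ _))) _.
apply: dom_add (dom_add (cZ _) (dom_add (cZ _) (dom_add (dom_mulr _ hK) (cZ _)))) _.
apply: dom_add (dom_add (cZ _) (dom_add (cZ _) (dom_add (dom_mulr _ hrho) (cZ _)))) _.
apply: dom_add (dom_add (cZ _) (dom_add (dom_mulr _ hrho) (cZ _))) _.
apply: dom_add (cZ _) _.
apply: dom_add (dom_add (dom_mulr _ hn) (cZ _)) _.
apply: dom_add.
  apply: dom_add _ (cZ _); rewrite /Z -mulnA; apply: dom_mul h1K _.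
  apply: dom_add (squareP _ _ _ _ n_gt0 K_gt0 le_rho) (dom_const _ _).
  by rewrite muln_gt0 K_gt0.
have hn1 : n <= 1 * Z by apply: leq_trans hn; rewrite leq_pmulr.
apply: dom_add _ (cZ _).
apply: (@leq_trans (n * (n * (csize (v_d <~ Const 0) +
    (csize min_cell + 40 + 40 + csize write_cell) + 40)))).
  rewrite leq_mul2l; apply/orP; right; clear -n_gt0; nia.
by rewrite mulnA; apply: dom_mulr _ hn.
Qed.

End Costs.

(** * The approximation ratio *)

Section Ratio.

Variables (n : nat) (e : rel 'I_n) (w : 'I_n -> 'I_n -> nat).

Let W := max_weight e w.

(** [wt w y q / size q] is the minimum mean. The lower estimate cuts cycles out of the witness walk,
    the upper one runs around the best cycle up to [T] edges; cross-multiplication keeps everything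
    in the naturals. *)
Lemma answer_ratio K T r E (x y : 'I_n) q num den :
  0 < n -> 0 < W -> 0 < E -> 0 < K -> 16 * (n * n) * W * E <= T ->
  16 * K * E <= r -> connect e x y -> closed_walk e y q -> size q <= n ->
  lower_mean e w x (wt w y q) (size q) -> answer e w W K T r x num den ->
  [/\ 0 < den, wt w y q * den <= num * size q
    & num * E * size q <= E.+1 * (wt w y q * den)].
Proof.
move=> n_gt0 W_gt0 E_gt0 K_gt0 leT le_r xy cw szq low [denE [d [up [p [xp szp le_p]] numE]]].
have lo := walk_lower low (connect0 e x) xp.
have q_gt0 : 0 < size q by have [q0 _ _] := cw; rewrite lt0n size_eq0.
set l := size q in szq lo q_gt0 *; set w0 := wt w y q in lo *.
pose a := n * n * W.
have n_le_a : n <= a by rewrite /a -mulnA leq_pmulr // muln_gt0 n_gt0.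
have leTa : 16 * a * E <= T by move: leT; rewrite /a !mulnA.
have a_gt0 : 0 < a := leq_trans n_gt0 n_le_a.
have le_aT : 16 * a <= T by apply: leq_trans leTa; rewrite leq_pmulr.
(* This says [b / r >= 1 - 1 / (4 * E)], since [4 * K] is at most [r / (4 * E)]. *)
have [b [rE b_ge]] : exists b, r = b + 4 * K /\ (4 * E).-1 * (4 * K) <= b.
  by exists (r - 4 * K); move: le_r K_gt0 E_gt0; clear; nia.
have le_nT : n <= T.
  by apply: leq_trans n_le_a _; apply: leq_trans le_aT; rewrite leq_pmull.
have [c TE] : exists c, T = c + n by exists (T - n); rewrite subnK.
have [p2 [xp2 szp2 le_p2]] : exists p, [/\ path e x p, size p = T
    & wt w x p * l <= w0 * T + 2 * n * W * l].
  exact: walk_upper.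
have le_d : d * l <= w0 * T + 2 * n * W * l.
  by apply: leq_trans le_p2; rewrite leq_mul2r up ?orbT.
have denbc : den = b * c by rewrite denE rE TE !addnK.
have b_gt0 : 0 < b.
  apply: leq_trans b_ge; rewrite muln_gt0; move: K_gt0 E_gt0; clear; lia.
have c_gt0 : 0 < c by move: TE n_le_a le_aT a_gt0; clear; lia.
have bK : r - 4 * K = b by rewrite rE addnK.
rewrite bK in le_p; rewrite szp TE in lo.
have lo' : w0 * c <= wt w x p * l by move: lo; clear; lia.
have lod : w0 * c * b <= r * d * l.
  apply: (@leq_trans (wt w x p * l * b)); first by rewrite leq_mul2r lo' orbT.
  by rewrite mulnAC leq_mul2r le_p orbT.
split; first by rewrite denbc muln_gt0 b_gt0.
- rewrite numE denbc; case: ifP => [_|/negbT]; last rewrite -leqNgt => small.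
    by move: lod; clear; lia.
  (* Otherwise [c * b <= w0 * c * b <= 2 * a * r], which [15 * a <= c] and [3 * r <= 4 * b]
     refute. *)
  suff -> : w0 = 0 by [].
  apply/eqP; rewrite -leqn0 leqNgt; apply/negP => w0_gt0.
  have r_le : 3 * r <= 4 * b by move: b_ge rE E_gt0 K_gt0; clear; nia.
  have dl : d * l <= 2 * a.
    apply: (@leq_trans (2 * n * W * n)); first exact: leq_mul.
    by rewrite /a; clear; lia.
  have : c * b <= r * (2 * a).
    apply: (@leq_trans (r * d * l)).
      by apply: leq_trans lod; rewrite leq_mul2r leq_pmull // orbT.
    by rewrite -mulnA leq_mul2l dl orbT.
  have c_ge : 15 * a <= c by move: TE n_le_a le_aT; clear; lia.
  have : 3 * (r * (2 * a)) <= 8 * a * b by move: r_le; clear; nia.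
  have : 15 * a * b <= c * b by rewrite leq_mul2r c_ge orbT.
  move: (leq_mul a_gt0 b_gt0); clear; nia.
- rewrite numE denbc; case: ifP => [big|//].
  (* Weights are integers, so [w0 >= 1], and the additive error [2 * n * W * l] is at most
     [2 * a * w0]. *)
  have w0_gt0 : 0 < w0.
    rewrite lt0n; apply: contraTneq big => w00; rewrite -leqNgt.
    by move: le_d; rewrite w00 mul0n add0n leq_mul2r eqn0Ngt q_gt0.
  have le_dl : d * l <= w0 * (T + 2 * a).
    apply: leq_trans le_d _; rewrite mulnDr leq_add2l.
    apply: (@leq_trans (2 * a)); last by rewrite leq_pmull.
    apply: (@leq_trans (2 * n * W * n)); first by rewrite leq_mul2l szq orbT.
    by rewrite /a; clear; lia.
  (* The factor [1 + 1 / E] is shared out: [r / b] takes [4 E / (4 E - 1)], and [(T + 2 * a) / c]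
     what is left. *)
  have key : (T + 2 * a) * r * E <= E.+1 * (b * c).
    have rb : (4 * E).-1 * r <= 4 * E * b.
      rewrite rE mulnDr; move: b_ge E_gt0; clear.
      case: E => // E + _; have -> : 4 * E.+1 = (4 * E + 3).+1 by lia.
      by rewrite [_.+1.-1]/=; nia.
    have cT : T <= c + a by rewrite TE leq_add2l.
    have leTa' := leTa.
    rewrite -(@leq_pmul2l (4 * E)); last by rewrite muln_gt0.
    have hE : 4 * E * E * (T + 2 * a) <= E.+1 * (4 * E).-1 * c.
      move: cT leTa' E_gt0 a_gt0; clear; case: E => // E cT leT _ a_gt0.
      have -> : (4 * E.+1).-1 = 4 * E + 3 by lia.
      nia.
    apply: (@leq_trans (E.+1 * (4 * E).-1 * c * r)).
      by have := leq_mul hE (leqnn r); clear; lia.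
    by have := leq_mul (leqnn (E.+1 * c)) rb; clear; lia.
  have := leq_mul (leqnn w0) key; have := leq_mul le_dl (leqnn (r * E)).
  by clear; lia.
Qed.

End Ratio.

Lemma flat_le n b (f : 'I_n -> 'I_n -> nat) p :
  (forall i j, f i j <= b) -> flat 0 f p <= b.
Proof. by move=> le_f; rewrite /flat; case: insubP => // i _ _; case: insubP. Qed.

(** For the least [k] with [eps * 2 ^ k >= 1], all earlier products lie below 1 and this one below
    2, which determines the digits. *)
Lemma first_digit (R : realType) (eps : R) : (0 < eps <= 1)%R ->
  exists k, [/\ forall j, j < k -> Num.truncn (eps * 2 ^+ j)%R %% 2 = 0,
    Num.truncn (eps * 2 ^+ k)%R %% 2 = 1, (1 <= eps * 2 ^+ k)%R
  & (eps * 2 ^+ k <= 2)%R].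
Proof.
move=> /andP[eps_gt0 eps_le1].
have ex : exists k, (1 <= eps * 2 ^+ k)%R.
  exists (Num.bound eps^-1); rewrite -ler_pdivrMl // mulr1.
  have /ltW/le_trans -> // := archi_boundP (ltW (eq_ind_r _ eps_gt0 (invr_gt0 eps))).
  by rewrite -natrX ler_nat ltnW // ltn_expl.
exists (ex_minn ex); case: ex_minnP => k ge1 min.
have lt1 j : j < k -> (eps * 2 ^+ j < 1)%R.
  by move=> lt_j; rewrite ltNge; apply/negP => /min; rewrite leqNgt lt_j.
have lt2 : (eps * 2 ^+ k < 2)%R.
  case: k ge1 min lt1 => [|k] _ _ lt1; first by rewrite expr0 mulr1; lra.
  by have := lt1 k (ltnSn k); rewrite exprS; lra.
have truncE m (x : R) : (m%:R <= x < m.+1%:R)%R -> Num.truncn x = m.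
  exact: truncn_def.
split=> //; last exact: ltW.
- move=> j /lt1 lt_j; rewrite (truncE 0) // lt_j andbT.
  by rewrite mulr_ge0 ?exprn_ge0 // ltW.
- by rewrite (truncE 1) // ge1.
Qed.

Definition scan_cost (n : nat) : nat :=
  csize (v_nn <~ Var v_n *' Var v_n) + (n * n * (csize scan_cell + 40) + 40).

Definition zero_cost (n : nat) : nat :=
  n * (csize (put a_den (Var v_x) (Const 1)) + 40) + 40.

(** * The whole program on the encoded input *)

Section Run.

Variables (R : realType) (n : nat) (e : rel 'I_n) (w : 'I_n -> 'I_n -> nat) (eps : R).

Hypothesis n_gt0 : 0 < n.

Let W := max_weight e w.
Let s0 := graph_input e w eps.

Lemma input_weight (x y : 'I_n) : arr s0 1 (x * n + y) = if e x y then w x y else 0.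
Proof. by rewrite /= flat_ord. Qed.

Lemma input_weight_le p : arr s0 1 p <= W.
Proof. by apply: flat_le => x y; case: ifP => // /(le_max_weight w). Qed.

Lemma input_bound B : n * n <= B -> W <= B -> sbound B s0.
Proof.
move=> nnB WB; have B_gt0 : 0 < B by apply: leq_trans nnB; rewrite muln_gt0 n_gt0.
split=> [x|[|[|[|a]]] p].
- by rewrite /=; case: ifP => // _; apply: leq_trans nnB; rewrite leq_pmulr.
- by apply: flat_le => x y; apply: leq_trans B_gt0; case: (e x y).
- exact: leq_trans (input_weight_le p) WB.
- by rewrite /=; apply: leq_trans B_gt0; rewrite -ltnS ltn_mod.
- by [].
Qed.

Lemma tri_scan B : n * n <= B -> W <= B ->
  tri B scan s0 (scan_cost n) (fun s => var s v_nn = n * n /\ var s v_W = W).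
Proof.
move=> nnB WB; apply: tri_seq_wp; rewrite /=; split=> //; set s1 := Store _ _.
pose I i s := var s v_W <= W /\ forall p, p < i -> arr s0 1 p <= var s v_W.
have tf : tri B (For v_p v_nn scan_cell) s1 (n * n * (csize scan_cell + 40) + 40)
    (fun s => I (n * n) s /\ var s v_p = n * n).
  apply: tri_for => // i s lt_i [v' a'] vp bs [leW ge].
  apply: wp_tri; rewrite /scan_cell [wp _ _ _ _]/= vp a' //.
  have le_i := input_weight_le i; rewrite [arr s1 1 i]/= in le_i *.
  have ltS p : p < i.+1 -> p = i \/ p < i.
    by rewrite ltnS leq_eqVlt => /orP[/eqP|]; auto.
  split=> [big|small].
    split; first exact: leq_trans le_i WB.
    split=> // p /ltS[-> //|/ge /leq_trans]; apply.
    by move: big; rewrite /=; clear; lia.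
  split=> // p /ltS[->|/ge //].
  by move: small; rewrite /=; clear; lia.
apply: tri_post (tri_agree tf) _ => s [[v' _] [[leW ge] _]].
split; first by rewrite v'.
apply/eqP; rewrite eqn_leq leW /=; apply/bigmax_leqP => -[x y] /= exy.
by have := ge _ (lt_cell x y); rewrite input_weight exy.
Qed.

Lemma tri_zero_output B s : var s v_n = n -> n * n <= B ->
  tri B zero_output s (zero_cost n) (fun s' => forall x : 'I_n, arr s' a_den x = 1).
Proof.
move=> sn nnB; have nB : n <= B by apply: leq_trans nnB; rewrite leq_pmulr.
pose I i s' := forall x, x < i -> arr s' a_den x = 1.
apply: (@tri_post _ _ _ _ (fun s' => I n s' /\ var s' v_x = n)) => [|s' [Is _] x].
  apply: tri_for => // i s' lt_i _ vx bs Ii; apply: wp_tri; rewrite /= vx.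
  split=> [|x]; first by apply: leq_trans nB.
  rewrite ltnS (leq_eqVlt x i) /=; case: eqVneq => //= _.
  exact: Ii.
exact: Is.
Qed.

Variable P : arith_prog.

Lemma run_zero_weight : W = 0 -> exists t s,
  [/\ ram_run (approx_mcm P) s0 t s,
      t <= (scan_cost n + (ecost (Var v_W) + zero_cost n)) * bitlen (n * n)
    & forall x : 'I_n, arr s a_num x = 0 /\ arr s a_den x = 1].
Proof.
move=> W0; have W_le : W <= n * n by rewrite W0.
have tz : tri (n * n) (approx_mcm P) s0
    (scan_cost n + (ecost (Var v_W) + zero_cost n))
    (fun s => forall x : 'I_n, arr s a_num x = 0 /\ arr s a_den x = 1).
  apply: tri_seq_agree (tri_scan _ W_le) _ => // s [v a] [snn sW].
  apply: tri_if; rewrite /= sW W0 // => _.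
  apply: tri_post (tri_agree (tri_zero_output _ _)) _ => //; first by rewrite v.
  by move=> s' [[_ a'] den] x; rewrite den a' // a.
have [t [s [r le_t _ out]]] := tz (input_bound (leqnn _) W_le).
by exists t, s.
Qed.

Variables (cap tau k K rho : nat).
Hypotheses (K_def : K = up_log 2 (16 * (n * n) * W * 2 ^ k)).
Hypothesis (rho_def : rho = up_log 2 (16 * K * 2 ^ k)).
Hypothesis digit0 : forall j, j < k -> Num.truncn (eps * 2 ^+ j)%R %% 2 = 0.
Hypothesis digit1 : Num.truncn (eps * 2 ^+ k)%R %% 2 = 1.
Hypothesis matmulP : forall A A' : 'M[int]_n, exists t a,
  [/\ arith_run cap P (matmul_input A A') t a,
      forall i j : 'I_n, entry a 2 (i * n + j) = (A *m A')%R i j & t <= tau].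
Hypothesis out_edge : forall x : 'I_n, exists y, e x y.

Lemma run_positive_weight : 0 < W -> exists t s,
  let r := 2 ^ rho in let B := n.+1 ^ r * n.+1 ^ r * n.+1 + cap in
  [/\ ram_run (approx_mcm P) s0 t s,
      t <= (scan_cost n + (ecost (Var v_W) + positive_cost n P k tau K rho)) * bitlen B
    & forall x : 'I_n, answer e w W K (2 ^ K) r x (arr s a_num x) (arr s a_den x)].
Proof.
move=> W_gt0; set r := 2 ^ rho; set M := n.+1 ^ r * n.+1 ^ r * n.+1; set B := M + cap.
have MB : M <= B := leq_addr _ _; have capB : cap <= B := leq_addl _ _.
have nnB : n * n <= B.
  exact: nn_le (erefl W) (erefl (2 ^ k)) K_def (erefl (2 ^ K)) rho_def
    (erefl r) (erefl n.+1) (erefl (n.+1 ^ r)) (erefl M) (erefl (2 * K * K + 1)) n_gt0 W_gt0 MB capB.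
have WB : W <= B.
  have le_TB : 2 ^ K <= B.
    exact: T_le (erefl W) (erefl (2 ^ k)) K_def (erefl (2 ^ K)) rho_def
    (erefl r) (erefl n.+1) (erefl (n.+1 ^ r)) (erefl M) (erefl (2 * K * K + 1)) n_gt0 W_gt0 MB capB.
  apply: leq_trans le_TB.
  have [+ _ _ _] := T_ge (erefl W) (erefl (2 ^ k)) K_def (erefl (2 ^ K)) rho_def
    (erefl r) (erefl n.+1) (erefl (n.+1 ^ r)) (erefl M) (erefl (2 * K * K + 1)) n_gt0 W_gt0 MB capB.
  by apply: leq_trans; rewrite leq_pmull.
have tp : tri B (approx_mcm P) s0
    (scan_cost n + (ecost (Var v_W) + positive_cost n P k tau K rho))
    (fun s => forall x : 'I_n, answer e w W K (2 ^ K) r x (arr s a_num x) (arr s a_den x)).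
  apply: tri_seq_agree (tri_scan nnB WB) _ => s [v a] [snn sW].
  apply: tri_if; rewrite /= sW => W0; last by rewrite W0 in W_gt0.
  apply: (tri_positive (erefl W) (erefl (2 ^ k)) K_def (erefl (2 ^ K)) rho_def
    (erefl r) (erefl n.+1) (erefl (n.+1 ^ r)) (erefl M) (erefl (2 * K * K + 1)) n_gt0 W_gt0 MB capB
    matmulP out_edge).
  have as0 b : arr s b = arr s0 b by rewrite a.
  have [vn vK vrho] : [/\ var s v_n = n, var s v_K = 0 & var s v_rho = 0].
    by rewrite !v.
  have [vg vk] : var s v_g = 0 /\ var s v_k = 0 by rewrite !v.
  split; rewrite // ?as0 //.
  - by move=> x y; rewrite /= flat_ord.
  - exact: input_weight.
  - by case=> [|[|[|b]]] q // _; rewrite as0.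
have [t [s [rn le_t _ out]]] := tp (input_bound nnB WB).
by exists t, s.
Qed.

End Run.

Lemma total_cost_le P : exists c, forall n k tau K rho,
  0 < n -> 0 < K -> k <= K -> rho <= 3 * K ->
  scan_cost n + (ecost (Var v_W) + positive_cost n P k tau K rho) <=
  c * (K * K * (n * n + tau)).
Proof.
have [cp costP] := positive_cost_le P.
eexists => n k tau K rho n_gt0 K_gt0 le_k le_rho; set Z := K * K * _.
have Z0 : 0 < Z by rewrite !muln_gt0 K_gt0 addn_gt0 muln_gt0 n_gt0.
have hn : n * n <= 1 * Z.
  by rewrite mul1n; apply: leq_trans (leq_addr tau _) _; rewrite leq_pmull // muln_gt0 K_gt0.
apply: dom_add (dom_add (dom_const _ Z0) (dom_add (dom_mulr _ hn) (dom_const _ Z0))) _.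
exact: dom_add (dom_const _ Z0) (costP _ _ _ _ _ n_gt0 K_gt0 le_k le_rho).
Qed.

Lemma zero_weight_cost_le : exists c, forall n, 0 < n ->
  (scan_cost n + (ecost (Var v_W) + zero_cost n)) * bitlen (n * n) <=
  c * (n * n * bitlen n).
Proof.
eexists => n n_gt0; have Z0 : 0 < n * n by rewrite muln_gt0 n_gt0.
have hnn : n * n <= 1 * (n * n) by rewrite mul1n.
have hn : n <= 1 * (n * n) by rewrite mul1n leq_pmulr.
apply: dom_mul.
  apply: dom_add (dom_add (dom_const _ Z0) (dom_add (dom_mulr _ hnn) (dom_const _ Z0))) _.
  exact: dom_add (dom_const _ Z0) (dom_add (dom_mulr _ hn) (dom_const _ Z0)).
by apply: (leq_trans (bitlenM n n)); rewrite addnn -mul2n.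
Qed.

Lemma bound_bitlen_le c d : exists b, forall n r, 0 < n -> 0 < r ->
  bitlen (n.+1 ^ r * n.+1 ^ r * n.+1 + c * n ^ d) <= b * (r * bitlen n).
Proof.
eexists => n r n_gt0 r_gt0; set Z := r * bitlen n.
have Z0 : 0 < Z by rewrite muln_gt0 r_gt0.
have hb : bitlen n <= 1 * Z by rewrite mul1n leq_pmull.
have hX : bitlen n.+1 <= 2 * bitlen n.
  rewrite -addn1; apply: leq_trans (bitlenD _ _) _.
  by rewrite mul2n -addnn leq_add2l.
have hX' : bitlen n.+1 <= 2 * Z by apply: leq_trans hX _; rewrite leq_mul2l leq_pmull.
have hXr : bitlen (n.+1 ^ r) <= 3 * Z.
  apply: leq_trans (bitlenX _ _) _; apply: (@dom_add Z 2 1) (dom_const _ Z0).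
  by rewrite /Z mulnCA leq_mul2l hX orbT.
apply: leq_trans (bitlenD _ _) _; apply: dom_add.
  apply: leq_trans (bitlenM _ _) _; apply: dom_add hX'.
  by apply: leq_trans (bitlenM _ _) _; apply: (dom_add hXr hXr).
apply: leq_trans (bitlenM _ _) _; apply: dom_add (dom_const _ Z0) _.
apply: leq_trans (bitlenX _ _) _; exact: dom_add (dom_mull _ hb) (dom_const _ Z0).
Qed.

Lemma up_log_lt m : 1 < m -> 2 ^ up_log 2 m < 2 * m.
Proof.
move=> m_gt1; have /andP[lt_m _] := up_log_bounds (isT : 1 < 2) m_gt1.
have : 0 < up_log 2 m by rewrite up_log_gt0.
by case: (up_log 2 m) lt_m => // l lt_m _; rewrite expnS ltn_pmul2l.
Qed.

(** * Logarithms and the final time bound *)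

Local Open Scope ring_scope.

Lemma log2_ge (R : realType) m (x : R) : 2 ^+ m <= x -> m%:R <= ln x / ln 2.
Proof.
move=> le_x; have x_gt0 : 0 < x by apply: lt_le_trans le_x; rewrite exprn_gt0.
have ln2 : 0 < ln 2 :> R by rewrite ln_gt0 // ltr1n.
by rewrite ler_pdivlMr // mulr_natl -lnXn // ler_ln ?posrE ?exprn_gt0.
Qed.

Lemma lg_ge1 (R : realType) (x : R) : 1 <= lg x.
Proof. by rewrite /lg le_max lexx. Qed.

Lemma log2_le_lg (R : realType) (x : R) : ln x / ln 2 <= lg x.
Proof. by rewrite /lg le_max lexx orbT. Qed.

Lemma bitlen_lg (R : realType) n : (0 < n)%N -> (bitlen n)%:R <= 2 * lg n%:R :> R.
Proof.
move=> n_gt0; rewrite /bitlen -natr1.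
have le_n : 2 ^+ trunc_log 2 n <= n%:R :> R by rewrite -natrX ler_nat trunc_logP.
have := le_trans (log2_ge le_n) (log2_le_lg n%:R); have := lg_ge1 (n%:R : R).
lra.
Qed.

(** The argument of [up_log] is at most [32 * z ^ 2] for [z = n W / eps]. Its logarithm, rounded up,
    is at most [6 + 2 * lg z], and [lg z >= 1]. *)
Lemma steps_le_lg (R : realType) (n W E : nat) (eps : R) :
  (0 < n)%N -> (0 < W)%N -> (0 < E)%N -> 0 < eps <= 1 -> E%:R * eps <= 2 ->
  (up_log 2 (16 * (n * n) * W * E))%:R <= 8 * lg (n%:R * W%:R / eps).
Proof.
move=> n_gt0 W_gt0 E_gt0 /andP[eps_gt0 eps_le1] le_E.
set m := (16 * (n * n) * W * E)%N; set z := n%:R * W%:R / eps.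
have nW : 1 <= n%:R * W%:R :> R by rewrite -natrM ler1n muln_gt0 n_gt0.
have z_ge1 : 1 <= z by rewrite ler_pdivlMr // mul1r (le_trans eps_le1).
have z_gt0 : 0 < z by apply: lt_le_trans z_ge1.
have m_gt1 : (1 < m)%N.
  by rewrite /m -!mulnA (@leq_trans 16) // leq_pmulr // !muln_gt0 n_gt0 W_gt0.
have le_m : m%:R <= 32 * z ^+ 2.
  have -> : 32 * z ^+ 2 = 16 * (n%:R * W%:R) * (n%:R * W%:R) * (2 / eps / eps) :> R.
    by rewrite /z; field; rewrite gt_eqF.
  have leE : E%:R <= 2 / eps by rewrite ler_pdivlMr.
  have leE' : E%:R <= 2 / eps / eps.
    apply: le_trans leE _; rewrite ler_pdivlMr // ger_pMr // divr_gt0 //.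
  rewrite /m !natrM.
  have W1 : 1 <= W%:R :> R by rewrite ler1n.
  have -> : 16 * (n%:R * n%:R) * W%:R * E%:R = (16 * (n%:R * W%:R) * n%:R) * E%:R :> R by ring.
  apply: ler_pM => //; rewrite ?mulr_ge0 //.
  by apply: ler_pM; rewrite ?mulr_ge0 // ler_peMr.
have le_pow : 2 ^+ (up_log 2 m).-1 <= 32 * z ^+ 2.
  apply: le_trans le_m; rewrite -natrX ler_nat.
  by have /andP[/ltnW] := up_log_bounds (isT : (1 < 2)%N) m_gt1.
have up_gt0 : (0 < up_log 2 m)%N by rewrite up_log_gt0.
have ln2 : 0 < ln 2 :> R by rewrite ln_gt0 // ltr1n.
have := log2_ge le_pow.
have -> : ln (32 * z ^+ 2) / ln 2 = 5 + 2 * (ln z / ln 2).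
  have ln32 : ln 32 = 5 * ln 2 :> R.
    by rewrite mulr_natl -lnXn ?ltr0n // -natrX.
  have z2_gt0 : 0 < z ^+ 2 by rewrite exprn_gt0.
  rewrite lnM ?posrE ?z2_gt0 ?ltr0n // ln32 (lnXn 2 z_gt0) -[ln z *+ 2]mulr_natl.
  by rewrite mulrDl mulfK ?gt_eqF // mulrA.
have := log2_le_lg z; have := lg_ge1 z.
rewrite -[up_log 2 m]prednK // -natr1; lra.
Qed.

Lemma output_ratio (R : realType) (eps : R) (num den w0 l E : nat) :
  (0 < den)%N -> (0 < l)%N -> (0 < E)%N -> 1 <= eps * E%:R ->
  (w0 * den <= num * l)%N -> (num * E * l <= E.+1 * (w0 * den))%N ->
  w0%:R / l%:R <= (num%:R / den%:R : R) <= (1 + eps) * (w0%:R / l%:R).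
Proof.
move=> den_gt0 l_gt0 E_gt0 leE low up.
have den0 : 0 < den%:R :> R by rewrite ltr0n.
have l0 : 0 < l%:R :> R by rewrite ltr0n.
have E0 : 0 < E%:R :> R by rewrite ltr0n.
apply/andP; split.
  rewrite ler_pdivrMr // mulrAC ler_pdivlMr // -!natrM ler_nat //.
have -> : (1 + eps) * (w0%:R / l%:R) = (1 + eps) * w0%:R / l%:R by rewrite mulrA.
rewrite ler_pdivrMr // mulrAC ler_pdivlMr //.
move: up; rewrite -(ler_nat R) !natrM -natr1 => up.
rewrite -(ler_pM2r E0).
have : (E%:R + 1) * (w0%:R * den%:R) <= (1 + eps) * E%:R * (w0%:R * den%:R) :> R.
  by apply: ler_wpM2r; rewrite ?mulr_ge0 //; lra.
by move: up; lra.
Qed.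

Theorem theorem2 (R : realType) (omega : R) (Homega : matmul_in_time omega) :
  exists (P : ram_prog) (C : R) (k : nat),
    forall (n : nat) (e : rel 'I_n) (w : 'I_n -> 'I_n -> nat) (eps : R),
      (0 < n)%N ->
      (forall x : 'I_n, exists y : 'I_n, e x y) ->
      0 < eps <= 1 ->
      let L : R := lg (n%:R * (max_weight e w)%:R / eps) in
      exists (t : nat) (s : store),
        [/\ ram_run P (graph_input e w eps) t s,
            forall x : 'I_n,
              (0 < arr s 4 x)%N /\
              exists2 mu : R, min_cycle_mean e w x mu
                & mu <= output R s x <= (1 + eps) * mu,
            t%:R <= C * (n%:R `^ omega / eps * L ^+ 3 * lg (L / eps) ^+ 2 * lg n%:R)
          & t%:R <= C * (n%:R `^ omega / eps * L ^+ 3 * lg n%:R ^+ k)].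
Proof.
have [P [C0 [c [d mulP]]]] := Homega.
have [cN costN] := total_cost_le P.
have [cZ costZ] := zero_weight_cost_le.
have [cB bitB] := bound_bitlen_le c d.
(* For [n = 1] the power of [n] is 1 whatever [omega] is. *)
have C0_ge0 : 0 <= C0.
  have [t [s [_ _ le_t]]] := mulP 1%N 0 0 isT.
  by move: le_t; rewrite powR1 mulr1; apply: le_trans.
(* [32 * 512 * 8] equals [8 * 8 * 2], from [K * K * (n * n + tau)], times [2 * 16 * 8 * 2 * 2], from
   the bit length. *)
pose C1 : R := (cZ * 2)%:R * C0; pose C2 : R := (cN * cB * 32 * 512 * 8)%:R * C0.
have C1_ge0 : 0 <= C1 by rewrite mulr_ge0.
have C2_ge0 : 0 <= C2 by rewrite mulr_ge0.
exists (approx_mcm P), (C1 + C2), 1%N => n e w eps n_gt0 out_edge eps01 L.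
have /andP[eps_gt0 eps_le1] := eps01.
set l := lg n%:R; set Y := n%:R `^ omega.
have Y_ge0 : 0 <= Y by apply: powR_ge0.
have Z_ge0 : 0 <= C0 * Y by rewrite mulr_ge0.
pose tau := Num.truncn (C0 * Y).
have tau_le : tau%:R <= C0 * Y by rewrite truncn_le.
have mulP' (A A' : 'M[int]_n) : exists t a,
    [/\ arith_run (c * n ^ d) P (matmul_input A A') t a,
      forall i j : 'I_n, entry a 2 (i * n + j) = (A *m A') i j & (t <= tau)%N].
  have [t [a [rn prod le_t]]] := mulP n A A' n_gt0.
  by exists t, a; split=> //; rewrite truncn_ge_nat.
have nn_tau : (n * n <= tau)%N.
  have [t [a [rn prod le_t]]] := mulP' (const_mx 1) (const_mx 1).
  exact: leq_trans (matmul_time_lower rn prod) le_t.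
have L_ge1 : 1 <= L := lg_ge1 _.
have l_ge1 : 1 <= l := lg_ge1 _.
have L_ge0 : 0 <= L := le_trans ler01 L_ge1.
have l_ge0 : 0 <= l := le_trans ler01 l_ge1.
have eps_ge0 := ltW eps_gt0.
have Ye : Y <= Y / eps by rewrite ler_pdivlMr // ler_piMr.
pose F := Y / eps * L ^+ 3 * l.
have YeL_ge0 : 0 <= Y / eps * L ^+ 3 by rewrite !mulr_ge0 ?exprn_ge0 ?invr_ge0.
have F_ge0 : 0 <= F by rewrite mulr_ge0.
(* The bound [F] is the second one with exponent 1, and the first one without a factor that is at
   least 1. *)
suff [t [s [rn correct le_t]]] : exists t s,
    [/\ ram_run (approx_mcm P) (graph_input e w eps) t s,
      forall x : 'I_n, (0 < arr s 4 x)%N /\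
        exists2 mu : R, min_cycle_mean e w x mu & mu <= output R s x <= (1 + eps) * mu
    & t%:R <= (C1 + C2) * F].
  exists t, s; split=> //.
  apply: le_trans le_t _; rewrite ler_wpM2l ?addr_ge0 // /F.
  by rewrite ler_wpM2r // ler_peMr // exprn_ege1 // lg_ge1.
have [W0|W_gt0] := posnP (max_weight e w).
  have [t [s [rn le_t out]]] := run_zero_weight eps n_gt0 P W0.
  exists t, s; split=> // [x|].
    have [num0 den1] := out x; rewrite den1; split=> //.
    have [y [q [xy cw szq low]]] := best_cycle w out_edge x.
    have [_ yq _] := cw; have w0 : wt w y q = 0%N.
      by apply/eqP; rewrite -leqn0 (leq_trans (wt_le w yq)) // W0 muln0.
    exists ((wt w y q)%:R / (size q)%:R); first exact: min_cycle_mean_best low.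
    by rewrite /output num0 w0 !mul0r mulr0 lexx.
  have le_t' := leq_trans le_t (costZ n n_gt0).
  apply: (@le_trans _ _ (C1 * F)); last by rewrite ler_wpM2r ?lerDl.
  apply: (@le_trans _ _ (cZ%:R * (C0 * Y * (2 * l)))).
    apply: (@le_trans _ _ (cZ * (n * n * bitlen n))%:R); first by rewrite ler_nat.
    rewrite natrM ler_wpM2l // natrM ler_pM ?bitlen_lg //.
    by apply: le_trans tau_le; rewrite ler_nat.
  have -> : cZ%:R * (C0 * Y * (2 * l)) = C1 * (Y * 1 * l).
    by rewrite /C1 natrM; ring.
  rewrite ler_wpM2l // ler_wpM2r ?(le_trans ler01) // ler_pM //.
  exact: exprn_ege1.
have [k [dig0 dig1 ge1 le2]] := first_digit eps01.
set W := max_weight e w in L W_gt0 L_ge1 L_ge0 F F_ge0 YeL_ge0 *.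
pose E := (2 ^ k)%N; have E_gt0 : (0 < E)%N by rewrite expn_gt0.
have ER : E%:R = 2 ^+ k :> R by rewrite /E natrX.
pose K := up_log 2 (16 * (n * n) * W * E).
pose rho := up_log 2 (16 * K * E).
have K_le : K%:R <= 8 * L by apply: steps_le_lg => //; rewrite ER mulrC.
have leT : (16 * (n * n) * W * E <= 2 ^ K)%N by apply: up_logP.
have leET : (16 * E <= 2 ^ K)%N.
  apply: leq_trans leT; rewrite leq_mul2r -!mulnA leq_pmulr ?orbT //.
  by rewrite !muln_gt0 n_gt0 W_gt0.
have leT16 : (16 <= 2 ^ K)%N by apply: leq_trans leET; rewrite leq_pmulr.
have K_gt0 : (0 < K)%N by case: (K) leT16.
have le_k : (k <= K)%N.
  by rewrite -(leq_exp2l _ _ (ltnSn 1)) (leq_trans _ leET) // leq_pmull.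
(* Decoding takes [rho + 1] rounds per entry; this keeps it within the cost of the [2 * K]
   scales. *)
have le_rho : (rho <= 3 * K)%N.
  apply: up_log_min => //; rewrite -mulnA (mulnC 3) expnM !expnS expn0 muln1.
  have ltK : (K < 2 ^ K)%N by rewrite ltn_expl.
  rewrite mulnCA; apply: leq_mul; first exact: ltnW.
  by apply: leq_trans leET _; rewrite leq_pmulr // expn_gt0.
have r_le : (2 ^ rho <= 2 * (16 * K * E))%N.
  apply/ltnW/up_log_lt; rewrite (@leq_trans 16) // -mulnA leq_pmulr //.
  by rewrite muln_gt0 K_gt0.
have [t [s [rn le_t out]]] :=
  run_positive_weight n_gt0 (erefl K) (erefl rho) dig0 dig1 mulP' out_edge W_gt0.
exists t, s; split=> // [x|].
  have [y [q [xy cw szq low]]] := best_cycle w out_edge x.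
  have q_gt0 : (0 < size q)%N by have [q0 _ _] := cw; rewrite lt0n size_eq0.
  have le_r : (16 * K * E <= 2 ^ rho)%N by apply: up_logP.
  have [den_gt0 lo up] :=
    answer_ratio n_gt0 W_gt0 E_gt0 K_gt0 leT le_r xy cw szq low (out x).
  split=> //; exists ((wt w y q)%:R / (size q)%:R); first exact: min_cycle_mean_best low.
  by apply: output_ratio den_gt0 q_gt0 E_gt0 _ lo up; rewrite ER.
have costs := costN n k tau K rho n_gt0 K_gt0 le_k le_rho.
have r_gt0 : (0 < 2 ^ rho)%N by rewrite expn_gt0.
have bits := bitB n (2 ^ rho)%N n_gt0 r_gt0.
apply: (@le_trans _ _ (C2 * F)); last by rewrite ler_wpM2r ?lerDr.
have le_nat : (t <= cN * (K * K * (n * n + tau)) *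
    (cB * (2 * (16 * K * E) * bitlen n)))%N.
  apply: leq_trans le_t _; apply: leq_mul => //; apply: leq_trans bits _.
  by rewrite leq_mul2l leq_mul2r r_le !orbT.
apply: (@le_trans _ _ (cN * (K * K * (n * n + tau)) *
    (cB * (2 * (16 * K * E) * bitlen n)))%:R); first by rewrite ler_nat.
have E_le : E%:R <= 2 / eps by rewrite ler_pdivlMr // ER mulrC.
have tau2 : (n * n + tau)%:R <= 2 * (C0 * Y).
  have : (n * n)%:R <= tau%:R :> R by rewrite ler_nat.
  by rewrite natrD; move: tau_le; lra.
have bl := bitlen_lg R n_gt0; rewrite -/l in bl.
have K_ge0 : 0 <= K%:R :> R by [].
apply: (@le_trans _ _ (cN%:R * (8 * L * (8 * L) * (2 * (C0 * Y))) *
    (cB%:R * (2 * (16 * (8 * L) * (2 / eps)) * (2 * l))))).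
  move: (n * n + tau)%N tau2 => a tau2; rewrite !natrM.
  have e0 : 0 <= 2 / eps by rewrite divr_ge0 // ltW.
  do ![apply: ler_pM => //; rewrite ?mulr_ge0 //].
by rewrite /C2 /F !natrM le_eqVlt; apply/orP; left; apply/eqP; field; rewrite gt_eqF.
Qed.
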